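(* Let $\beta$ be a real number such that both $\beta$ and $\beta^2$ are irrational and non-Liouville. There exist a constant $c=c(\beta)>0$ and an absolute constant $C>0$ such that the following holds. Let $N$ be a positive integer and let $A\subseteq\{1,\dots,N\}$ be a set of integers for which there are no solutions to $$a-a'=n\lfloor \beta n\rfloor$$ with distinct $a,a'\in A$ and $n\in\mathbb{N}=\{1,2,\dots\}$. Then $|A|\le C N^{1-c}$.
   Context: A real number $\beta$ is non-Liouville if there exist $m=m(\beta)>0$ and $M=M(\beta)\ge 1$ such that the inequality $0<\left|\beta-\frac{a}{q}\right|<\frac{m}{q^M}$ has no solutions in integers $a,q$ with $q\ge 1$. (All rationals are non-Liouville.) $\lfloor x\rfloor$ denotes the greatest integer $\le x$. *)

(* Defs.v *)
From mathcomp Require Import all_boot all_order all_algebra finmap.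
From mathcomp Require Import classical_sets reals exp.

Set Implicit Arguments.
Unset Strict Implicit.
Unset Printing Implicit Defensive.

Import Order.TTheory GRing.Theory Num.Theory.
Local Open Scope ring_scope.

(* The exponent M is a real number, so q ^ M is written with powR; as q >= 1
   this is the usual power. *)
Definition non_liouville (R : realType) (beta : R) : Prop :=
  exists m M : R, [/\ 0 < m, 1 <= M &
    forall a q : int, 1 <= q ->
      ~ (0 < `|beta - a%:~R / q%:~R| < m / (q%:~R `^ M))].

Definition no_bracket_difference (R : realType) (beta : R) (A : {fset int}) : Prop :=
  forall (a a' : int) (n : nat), a \in A -> a' \in A -> a != a' -> (0 < n)%N ->
    a - a' <> n%:Z * Num.floor (beta * n%:R).

(* Main.v *)
Require Import Defs.
From mathcomp Require Import all_boot all_order all_algebra finmap.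
From mathcomp Require Import classical_sets reals exp.
From mathcomp Require Import topology normedtype derive trigo.
From mathcomp Require Import ring lra zify.

(** Write [e(x) = cos (2 pi x)]. If [A - A] avoids the values [n floor (beta n)],
    then a cosine polynomial [F(theta) = sum_n w_n e(theta n floor (beta n))] of
    total mass 1 with [F >= - eps] everywhere forces [|A| <= 2 N eps]; so a
    power saving follows from such an [F] with [eps] a negative power of [N].

    By Dirichlet and the Diophantine condition on [beta] there is an
    approximation [a / b] of [beta] with [b] a power of [N]; complete [(b, a)]
    to a unimodular basis with [(m, p)]. Near the middle of the strip
    [0 <= beta x - y < 1] the points [(x, y)] with [y = floor (beta x)] are exactly
    the combinations of these two vectors, and [n floor (beta n) = x y] is a
    binary quadratic form there.

    If [F(theta) < - eps], then Weyl's inequality along the directions [(m, p)],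
    [(b, a)] and their sum shows that, for a small [q], the vector
    [q theta v] with [v = (m p, m a + b p, b a)] is close to an integer vector [w].
    If [v] and [w] are not parallel, their cross product is a small integral
    relation between the coordinates of [v], and this gives a very good
    rational approximation of [beta ^ 2], which is excluded. Otherwise [w] is a
    multiple of the primitive vector [v], so [theta = s / q + eta] with [eta] tiny.

    For such [theta], [F(theta)] is nearly [g F(eta)] with [g >= 0] a normalised
    sum of [e(s x y / q)] over all residues [x, y]; and [F(eta) >= - eps] since the
    weights are chosen so that, in the variable [x ^ 2], they form a Fejer kernel. *)

Set Implicit Arguments.
Unset Strict Implicit.
Unset Printing Implicit Defensive.
Import Order.TTheory GRing.Theory Num.Theory.
Import numFieldNormedType.Exports.
Local Open Scope ring_scope.

(** * Trigonometric sums *)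

Lemma cos_lipschitz (R : realType) (x y : R) : `|cos x - cos y| <= `|x - y|.
Proof.
wlog xy : x y / x <= y => [H|].
  by case: (leP x y) => [/H //|/ltW /H]; rewrite distrC (distrC y).
rewrite distrC (distrC x).
have [c _ ->] : exists2 c, c \in `[x, y]%R & cos y - cos x = - sin c * (y - x).
  apply: MVT_segment => //; apply: continuous_subspaceT.
  exact: continuous_cos.
rewrite normrM normrN ler_piMl ?normr_ge0 //; exact: sin_max.
Qed.

Lemma pi_lt4 (R : realType) : (pi : R) < 4.
Proof. by have := @pihalf_lt2 R; lra. Qed.

Lemma sinDpiz (R : realType) (x : R) (z : int) : `|sin (x + pi * z%:~R)| = `|sin x|.
Proof.
have nat_case (y : R) (n : nat) : `|sin (y + pi * n%:R)| = `|sin y|.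
  by rewrite mulr_natr (alternatingn (@sinDpi R)) normrM normrX normrN1 expr1n mul1r.
case: z => n; first by rewrite -(nat_case x n).
by rewrite NegzE -(nat_case _ n.+1) mulrNz mulrN subrK.
Qed.

Lemma cosD2piz (R : realType) (x : R) (z : int) : cos (x + 2 * pi * z%:~R) = cos x.
Proof.
have nat_case (y : R) (n : nat) : cos (y + 2 * pi * n%:R) = cos y.
  by rewrite mulr_natr mulr_natl (periodicn (@cosD2pi R)).
case: z => n; first by rewrite -(nat_case x n).
by rewrite NegzE -(nat_case _ n.+1) mulrNz mulrN subrK.
Qed.

Lemma sinD2piz (R : realType) (x : R) (z : int) : sin (x + 2 * pi * z%:~R) = sin x.
Proof. by rewrite -!cosBpihalf addrAC cosD2piz. Qed.

Lemma cos_piquarter_ge (R : realType) : 1 / 2 <= cos (pi / 4 : R).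
Proof.
have pi0 := @pi_gt0 R.
have h : cos (pi / 4 : R) ^+ 2 = 1 / 2.
  have : cos ((pi / 4 : R) *+ 2) = 0 by rewrite -mulr_natr -cos_pihalf; congr cos; lra.
  by rewrite cos_mulr2n; lra.
have c0 : 0 < cos (pi / 4 : R) by apply: cos_gt0_pihalf; lra.
by nra.
Qed.

(** Up to [1 / 4] the mean value theorem applies with [cos >= 1 / 2] and [pi >= 2]; beyond that the
    sine is already at least [1 / 2]. *)
Lemma sin_pi_ge (R : realType) (y : R) : 0 <= y <= 1 / 2 -> y <= sin (pi * y).
Proof.
move=> /andP[y0 y1]; have pi2 := @pi_ge2 R; have c4 := @cos_piquarter_ge R.
have cge (t : R) : 0 <= t <= pi / 4 -> 1 / 2 <= cos t.
  move=> /andP[t0 t1]; apply: (le_trans c4); rewrite leNgt ltr_cos ?in_itv /=; lra.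
have [y4|y4] := leP y (1 / 4).
  have [c /andP[c0 c1] /=] : exists2 c, 0 <= c <= pi * y &
      sin (pi * y) - sin 0 = cos c * (pi * y - 0).
    have [||c] := @MVT_segment R sin cos 0 (pi * y); first by nra.
      by apply: continuous_subspaceT; exact: continuous_sin.
    by rewrite in_itv /= => ? ?; exists c.
  rewrite sin0 !subr0 => ->; have py : pi * y <= pi / 4 by nra.
  have : 1 / 2 <= cos c by apply: cge; lra.
  by nra.
have -> : pi * y = pi / 2 - (pi / 2 - pi * y) by lra.
rewrite -[X in sin X]opprB sinN sinBpihalf opprK.
have py1 : pi / 4 <= pi * y by nra.
have py2 : pi * y <= pi / 2 by nra.
have : 1 / 2 <= cos (pi / 2 - pi * y) by apply: cge; lra.
lra.
Qed.

(** Converts a small sine, the quantity that controls sums along progressions, into closeness to an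
    integer. *)
Lemma near_int_sin (R : realType) (x : R) :
  exists z : int, `|x - z%:~R| <= `|sin (pi * x)|.
Proof.
exists (Num.floor (x + 1 / 2)); set z := Num.floor _.
have /andP[z1 z2] : z%:~R <= x + 1 / 2 < (z + 1)%:~R by rewrite floor_le floorD1_gt.
rewrite intrD in z2; set y := x - z%:~R.
have y1 : - (1 / 2) <= y <= 1 / 2 by rewrite /y; lra.
have -> : pi * x = pi * y + pi * z%:~R by rewrite /y; ring.
rewrite sinDpiz; have [y0|y0] := leP 0 y.
  by rewrite ger0_norm //; apply: le_trans (ler_norm _); apply: sin_pi_ge; lra.
rewrite ltr0_norm // -normrN -sinN -mulrN; apply: le_trans (ler_norm _).
by apply: sin_pi_ge; lra.
Qed.

(** Real and imaginary parts of the character [exp (2 pi i x)], kept as a pair of real functions. *)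
Definition ecos (R : realType) (x : R) : R := cos (2 * pi * x).
Definition esin (R : realType) (x : R) : R := sin (2 * pi * x).

Section Ecos.
Context {R : realType}.
Implicit Types x y : R.

Lemma ecosD x y : ecos (x + y) = ecos x * ecos y - esin x * esin y.
Proof. by rewrite /ecos mulrDr cosD. Qed.

Lemma ecosB x y : ecos (x - y) = ecos x * ecos y + esin x * esin y.
Proof. by rewrite /ecos mulrBr cosB. Qed.

Lemma esinD x y : esin (x + y) = esin x * ecos y + ecos x * esin y.
Proof. by rewrite /ecos /esin mulrDr sinD. Qed.

Lemma ecosN x : ecos (- x) = ecos x.
Proof. by rewrite /ecos mulrN cosN. Qed.

Lemma esinN x : esin (- x) = - esin x.
Proof. by rewrite /esin mulrN sinN. Qed.

Lemma ecos0 : ecos (0 : R) = 1.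
Proof. by rewrite /ecos mulr0 cos0. Qed.

Lemma esin0 : esin (0 : R) = 0.
Proof. by rewrite /esin mulr0 sin0. Qed.

Lemma ecosDz x (z : int) : ecos (x + z%:~R) = ecos x.
Proof. by rewrite /ecos mulrDr cosD2piz. Qed.

Lemma esinDz x (z : int) : esin (x + z%:~R) = esin x.
Proof. by rewrite /esin mulrDr sinD2piz. Qed.

Lemma ecosz (z : int) : ecos (z%:~R : R) = 1.
Proof. by rewrite -[_%:~R]add0r ecosDz ecos0. Qed.

Lemma esinz (z : int) : esin (z%:~R : R) = 0.
Proof. by rewrite -[_%:~R]add0r esinDz esin0. Qed.

Lemma ecos_le1 x : `|ecos x| <= 1.
Proof. exact: cos_max. Qed.

Lemma ecos_lipschitz x y : `|ecos x - ecos y| <= 8 * `|x - y|.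
Proof.
apply: le_trans (cos_lipschitz _ _) _.
rewrite -mulrBr normrM ler_wpM2r // ger0_norm; last by rewrite mulr_ge0 ?pi_ge0.
by have := pi_lt4 R; lra.
Qed.

Lemma ecos_telescope x y :
  2 * sin (pi * x) * ecos y = esin (y + x / 2) - esin (y - x / 2).
Proof.
have -> : pi * x = 2 * pi * (x / 2) by lra.
rewrite -/(esin (x / 2)) !esinD esinN ecosN; ring.
Qed.

Lemma esin_telescope x y :
  2 * sin (pi * x) * esin y = ecos (y - x / 2) - ecos (y + x / 2).
Proof.
have -> : pi * x = 2 * pi * (x / 2) by lra.
rewrite -/(esin (x / 2)) !ecosD esinN ecosN; ring.
Qed.

(** Multiplication by [2 * sin (pi * x)] makes the sum telescope. *)
Lemma sum_ecos_linear x y n :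
  2 * sin (pi * x) * \sum_(s < n) ecos (x * s%:R + y)
  = esin (x * (n%:R - 1 / 2) + y) - esin (y - x / 2).
Proof.
elim: n => [|n IH].
  rewrite big_ord0 mulr0 -[LHS](subrr (esin (y - x / 2))).
  by congr (esin _ - _); ring.
rewrite big_ord_recr /= mulrDr IH ecos_telescope -[n.+1%:R]natr1.
have -> : x * n%:R + y - x / 2 = x * (n%:R - 1 / 2) + y by ring.
have -> : x * n%:R + y + x / 2 = x * (n%:R + 1 - 1 / 2) + y by field.
ring.
Qed.

Lemma sum_esin_linear x y n :
  2 * sin (pi * x) * \sum_(s < n) esin (x * s%:R + y)
  = ecos (y - x / 2) - ecos (x * (n%:R - 1 / 2) + y).
Proof.
elim: n => [|n IH].
  rewrite big_ord0 mulr0 -[LHS](subrr (ecos (y - x / 2))).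
  by congr (_ - ecos _); ring.
rewrite big_ord_recr /= mulrDr IH esin_telescope -[n.+1%:R]natr1.
have -> : x * n%:R + y - x / 2 = x * (n%:R - 1 / 2) + y by ring.
have -> : x * n%:R + y + x / 2 = x * (n%:R + 1 - 1 / 2) + y by field.
ring.
Qed.

Lemma sum_ecos_linear_le x y n :
  `|sin (pi * x)| * `|\sum_(s < n) ecos (x * s%:R + y)| <= 1.
Proof.
have : `|2 * sin (pi * x) * \sum_(s < n) ecos (x * s%:R + y)| <= 1 + 1.
  rewrite sum_ecos_linear; apply: le_trans (ler_normB _ _) _.
  by apply: lerD; exact: sin_max.
by rewrite !normrM (ger0_norm (ler0n _ 2)); lra.
Qed.

Lemma sin_pi_div_neq0 (d : int) (P : nat) :
  (0 < P)%N -> ~~ (P %| d)%Z -> sin (pi * (d%:~R / P%:R) : R) != 0.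
Proof.
move=> P0 nPd; apply/eqP => s0.
have P0' : (P%:R : R) != 0 by rewrite pnatr_eq0 -lt0n.
have [z] := near_int_sin (d%:~R / P%:R : R).
rewrite s0 normr0 normr_le0 subr_eq0 => /eqP h.
have : (d%:~R : R) = (z * P)%:~R by rewrite intrM -h -mulrA [_^-1 * _]mulrC divff ?mulr1.
by move=> /intr_inj dz; rewrite dz dvdz_mull in nPd.
Qed.

(** The two boundary terms of the telescoped sum differ by the integer [d], hence cancel, and the
    sine in front is nonzero. *)
Lemma sum_ecos_root (d : int) (P : nat) : (0 < P)%N -> ~~ (P %| d)%Z ->
  \sum_(r < P) ecos ((d%:~R / P%:R) * r%:R : R) = 0.
Proof.
move=> P0 nPd; have s0 := sin_pi_div_neq0 P0 nPd.
have P0' : (P%:R : R) != 0 by rewrite pnatr_eq0 -lt0n.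
have := sum_ecos_linear (d%:~R / P%:R) 0 P.
under eq_bigr do rewrite addr0.
have -> : d%:~R / P%:R * (P%:R - 1 / 2) + 0 = 0 - (d%:~R / P%:R) / 2 + d%:~R :> R by field.
rewrite esinDz subrr => /eqP; rewrite !mulf_eq0 (negbTE s0) orbF pnatr_eq0 /=.
by move=> /eqP.
Qed.

Lemma sum_esin_root (d : int) (P : nat) : (0 < P)%N ->
  \sum_(r < P) esin ((d%:~R / P%:R) * r%:R : R) = 0.
Proof.
move=> P0; have P0' : (P%:R : R) != 0 by rewrite pnatr_eq0 -lt0n.
have [|nPd] := boolP (P %| d)%Z.
  move=> /dvdzP[z ->]; rewrite big1 // => i _.
  rewrite intrM -[(Posz P)%:~R]/(P%:R : R) mulfK // -[i%:R]/((Posz i)%:~R : R) -intrM.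
  exact: esinz.
have s0 := sin_pi_div_neq0 P0 nPd.
have := sum_esin_linear (d%:~R / P%:R) 0 P.
under eq_bigr do rewrite addr0.
have -> : d%:~R / P%:R * (P%:R - 1 / 2) + 0 = 0 - (d%:~R / P%:R) / 2 + d%:~R :> R by field.
rewrite ecosDz subrr => /eqP; rewrite !mulf_eq0 (negbTE s0) orbF pnatr_eq0 /=.
by move=> /eqP.
Qed.

End Ecos.

(** * Weyl's inequality *)

(** Weyl differencing and the Fejer kernel both need a double sum sorted by the lag [s - t];
    symmetry pairs each positive lag with its negative. *)
Lemma sum_square_symmetric (R : comNzRingType) (G : nat -> nat -> R) (n : nat) :
  (forall s t, G s t = G t s) ->
  \sum_(s < n) \sum_(t < n) G s t
  = \sum_(s < n) G s s + 2 * \sum_(h < n) \sum_(t < n - h.+1) G (t + h.+1)%N t.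
Proof.
move=> Gsym; elim: n => [|n IH]; first by rewrite !big_ord0 mulr0 addr0.
rewrite big_ord_recr /=.
under eq_bigr do rewrite big_ord_recr /=.
rewrite big_split /= IH !big_ord_recr /= subnn big_ord0 addr0.
under [\sum_(h < n) \sum_(t < n.+1 - _) _]eq_bigr => h _.
  have -> : (n.+1 - h.+1 = (n - h.+1).+1)%N by have := ltn_ord h; lia.
  rewrite big_ord_recr /=.
  over.
rewrite big_split /= [\sum_(i < n) G (n - i.+1 + i.+1)%N _](_ : _ = \sum_(i < n) G n i); last first.
  rewrite [RHS](reindex_inj rev_ord_inj) /=; apply: eq_bigr => i _.
  by congr G; have := ltn_ord i; lia.
rewrite [\sum_(s < n) G s n](_ : _ = \sum_(i < n) G n i); last by apply: eq_bigr.
ring.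
Qed.

(* Otherwise the translates [B + j d], [j <= J], would be disjoint in [0, 2U). *)

Lemma difference_multiple (U J d : nat) (B : {set 'I_U}) :
  (J * d <= U)%N -> (2 * U < J.+1 * #|B|)%N ->
  exists (j : nat) (h h' : 'I_U),
    [/\ (0 < j <= J)%N, h \in B, h' \in B & h = (h' + j * d)%N :> nat].
Proof.
move=> JdU cB.
have U0 : (0 < U)%N.
  case: U B cB {JdU} => // B; have := max_card (mem B).
  by rewrite card_ord leqn0 => /eqP ->; rewrite !muln0.
have bound (x : 'I_J.+1 * 'I_U) : (x.2 + x.1 * d < 2 * U)%N.
  case: x => j h /=; have := ltn_ord h; have := ltn_ord j.
  have : (j <= J -> j * d <= J * d)%N by move=> ?; rewrite leq_mul2r orbC; apply/orP; left.
  lia.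
pose f x : 'I_(2 * U) := Ordinal (bound x).
have : ~ {in finset.setX [set: 'I_J.+1] B &, injective f}.
  move=> /card_in_imset; have := max_card (mem (f @: finset.setX [set: 'I_J.+1] B)).
  rewrite card_ord => /[swap] ->.
  by rewrite cardsX cardsT card_ord; lia.
move=> ninj.
pose S := finset.setX [set: 'I_J.+1] B.
have : [exists x, exists y, [&& x \in S, y \in S, f x == f y & (x.1 < y.1)%N]].
  apply: contraT => /existsPn nex; exfalso; apply: ninj => -[j h] [j' h'] xB yB fxy.
  have sub u v : u \in S -> v \in S -> f u = f v -> ~~ (u.1 < v.1)%N.
    move=> uB vB fuv; apply/negP => lt_uv.
    have /negP[] := nex u; apply/existsP; exists v.
    by rewrite uB vB fuv eqxx.
  have jj' : j = j'.
    have := sub _ _ xB yB fxy; have := sub _ _ yB xB (esym fxy).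
    by rewrite /= -!leqNgt => ? ?; apply: val_inj => /=; lia.
  congr (_, _) => //; apply: val_inj; move/(congr1 val): fxy => /=.
  by rewrite jj' => /addIn.
move=> /existsP[[j h] /existsP[[j' h'] /and4P[]]]; rewrite !inE /=.
move=> hB h'B /eqP /(congr1 val) /= e lt.
exists (j' - j)%N, h, h'; split=> //; first by have := ltn_ord j'; lia.
rewrite mulnBl; have : (j * d <= j' * d)%N by rewrite leq_mul2r (ltnW lt) orbT.
lia.
Qed.

Section Weyl.
Context {R : realType}.
Implicit Types alpha lambda mu : R.

(** Weyl differencing: adding the square of the sine sum gives the squared modulus of the
    exponential sum, and at a fixed lag the difference of two quadratic phases is linear in [t]. *)
Lemma sum_cos_sq_le alpha lambda mu (U : nat) :
  (\sum_(t < U) ecos (alpha * t%:R ^+ 2 + lambda * t%:R + mu)) ^+ 2 <=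
  U%:R + 2 * \sum_(h < U)
     `|\sum_(t < U - h.+1) ecos (2 * alpha * h.+1%:R * t%:R
          + (alpha * h.+1%:R ^+ 2 + lambda * h.+1%:R))|.
Proof.
pose f (t : nat) := alpha * t%:R ^+ 2 + lambda * t%:R + mu.
have -> : \sum_(t < U) ecos (alpha * t%:R ^+ 2 + lambda * t%:R + mu) = \sum_(t < U) ecos (f t) by [].
apply: le_trans (_ : _ <= (\sum_(t < U) ecos (f t)) ^+ 2 + (\sum_(t < U) esin (f t)) ^+ 2) _.
  by rewrite lerDl sqr_ge0.
have -> : (\sum_(t < U) ecos (f t)) ^+ 2 + (\sum_(t < U) esin (f t)) ^+ 2
    = \sum_(s < U) \sum_(t < U) ecos (f s - f t).
  rewrite !expr2 !big_distrlr /= -big_split; apply: eq_bigr => s _ /=.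
  by rewrite -big_split; apply: eq_bigr => t _; rewrite ecosB.
rewrite (sum_square_symmetric (G := fun s t => ecos (f s - f t))); last first.
  by move=> s t; rewrite -ecosN opprB.
apply: lerD.
  under eq_bigr do rewrite subrr ecos0.
  by rewrite sumr_const card_ord.
rewrite ler_wpM2l //; apply: ler_sum => h _; apply: le_trans (ler_norm _) _.
rewrite le_eqVlt; apply/orP; left; apply/eqP; congr `|_|; apply: eq_bigr => t _.
by congr ecos; rewrite /f natrD; ring.
Qed.

Lemma sum_ecos_le (n : nat) (f : nat -> R) : `|\sum_(t < n) ecos (f t)| <= n%:R.
Proof.
apply: le_trans (ler_norm_sum _ _ _) _.
rewrite -[n in n%:R]card_ord -sumr_const; apply: ler_sum => i _; exact: ecos_le1.
Qed.

(** The lags whose linear inner sum is not forced by its sine to be at most [U / (8 H^2)]. *)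
Definition small_differences alpha (U H : nat) : {set 'I_U} :=
  [set h : 'I_U | `|sin (pi * (2 * alpha * h.+1%:R))| * U%:R < 8 * H%:R ^+ 2].

(** The squared sum is at least [U^2 / H^2]. The diagonal and the lags outside the set account for
    at most half of it, so the lags in the set, each worth at most [U], must be numerous. *)
Lemma weyl_large_differences alpha lambda mu (U H : nat) :
  (0 < H)%N -> (4 * H ^ 2 <= U)%N ->
  U%:R <= H%:R * `|\sum_(t < U) ecos (alpha * t%:R ^+ 2 + lambda * t%:R + mu)| ->
  (2 * U < (8 * H ^ 2).+1 * #|small_differences alpha U H|)%N.
Proof.
move=> H0 HU large; set B := small_differences _ _ _; set S := \sum_(t < U) _ in large.
have H1 : (1 : R) <= H%:R by rewrite ler1n.
have HU' : 4 * H%:R ^+ 2 <= U%:R :> R by rewrite -natrX -natrM ler_nat.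
have U0 : (0 : R) < U%:R by nra.
pose T (h : 'I_U) := `|\sum_(t < U - h.+1) ecos (2 * alpha * h.+1%:R * t%:R
          + (alpha * h.+1%:R ^+ 2 + lambda * h.+1%:R))|.
have TU h : T h <= U%:R.
  have := sum_ecos_le (U - h.+1) (fun t => 2 * alpha * h.+1%:R * t%:R
          + (alpha * h.+1%:R ^+ 2 + lambda * h.+1%:R)).
  by move=> /le_trans; apply; rewrite ler_nat leq_subr.
have sumT : 8 * H%:R ^+ 2 * \sum_(h < U) T h <= 8 * H%:R ^+ 2 * U%:R * #|B|%:R + U%:R ^+ 2.
  rewrite (bigID (mem B)) /= mulrDr; apply: lerD.
    rewrite -[leRHS]mulrA ler_wpM2l ?mulr_ge0 ?sqr_ge0 //.
    by rewrite mulr_natr -sumr_const; apply: ler_sum => h _; exact: TU.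
  have -> : U%:R ^+ 2 = \sum_(h < U) U%:R :> R by rewrite sumr_const card_ord expr2 mulr_natl.
  rewrite mulr_sumr.
  rewrite [leRHS](bigID (mem B)) /= -[leLHS]add0r; apply: lerD; first exact: sumr_ge0.
  apply: ler_sum => h; rewrite inE -leNgt => hB.
  have := sum_ecos_linear_le (2 * alpha * h.+1%:R)
     (alpha * h.+1%:R ^+ 2 + lambda * h.+1%:R) (U - h.+1); rewrite -/(T h).
  set s := `|sin _| in hB *; have T0 : 0 <= T h by exact: normr_ge0.
  by move=> sT; nra.
have S2 : U%:R ^+ 2 <= H%:R ^+ 2 * (U%:R + 2 * \sum_(h < U) T h).
  apply: le_trans (_ : _ <= H%:R ^+ 2 * S ^+ 2) _; last first.
    by rewrite ler_wpM2l ?sqr_ge0 //; exact: sum_cos_sq_le.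
  rewrite -(real_normK (num_real S)) -exprMn; apply: lerXn2r => //; rewrite nnegrE //.
  by rewrite mulr_ge0.
rewrite -(ltr_nat R) !natrM -[(8 * H ^ 2).+1%:R]natr1 natrM natrX.
set T1 := \sum_(h < U) T h in sumT S2; set b := #|B|%:R in sumT *.
have : U%:R * (2 * U%:R) < U%:R * ((8 * H%:R ^+ 2 + 1) * b); last by rewrite ltr_pM2l.
have b0 : 0 <= b by [].
set u := U%:R in S2 sumT U0 HU' *; set k := H%:R ^+ 2 in HU' sumT S2 *.
have k1 : 1 <= k by rewrite /k; nra.
have : 4 * u ^+ 2 <= 4 * k * u + (8 * k * u * b + u ^+ 2) by nra.
have : 4 * k * u <= u ^+ 2 by nra.
move=> h1 h2.
have h3 : 2 * u ^+ 2 <= 8 * k * u * b by lra.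
suff : 0 < u * b by lra.
have : 0 < u * b * k by nra.
by rewrite pmulr_lgt0 //; lra.
Qed.

(** Bootstrapped pigeonhole. Unit steps give [j] with [2 alpha j] within [16 H^2 / U] of an integer.
    If the error were not much smaller still, a second round with step [i0 * j] would produce a
    multiple of it that is both beyond that tolerance and within it. *)
Lemma weyl alpha lambda mu (U H : nat) :
  (0 < H)%N -> (272 * H ^ 4 <= U)%N ->
  U%:R <= H%:R * `|\sum_(t < U) ecos (alpha * t%:R ^+ 2 + lambda * t%:R + mu)| ->
  exists (q : nat) (z : int), (0 < q <= 16 * H ^ 2)%N /\
    `|q%:R * alpha - z%:~R| * U%:R ^+ 2 <= 2048 * H%:R ^+ 6.
Proof.
move=> H0 HU large.
have HU2 : (8 * H ^ 2 * 1 <= U)%N.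
  apply: leq_trans HU; have : (H ^ 2 * 1 <= H ^ 2 * H ^ 2)%N by rewrite leq_mul2l expn_gt0 H0 orbT.
  by rewrite -expnD; lia.
have H1 : (1 : R) <= H%:R by rewrite ler1n.
have HU' : 272 * H%:R ^+ 4 <= U%:R :> R by rewrite -natrX -natrM ler_nat.
have := weyl_large_differences H0 _ large; set B := small_differences _ _ _ => cB.
have {}cB : (2 * U < (8 * H ^ 2).+1 * #|B|)%N by apply: cB; lia.
have U0 : (0 : R) < U%:R.
  by apply: lt_le_trans HU'; rewrite mulr_gt0 // exprn_gt0 //; lra.
set u : R := U%:R in U0 HU' *; set k : R := H%:R in H1 HU' *.
have near (h h' : 'I_U) (n : nat) : h \in B -> h' \in B -> h = (h' + n)%N :> nat ->
    exists z : int, `|2 * alpha * n%:R - z%:~R| * u < 16 * k ^+ 2.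
  rewrite !inE => hB h'B e.
  have [z1 z1P] := near_int_sin (2 * alpha * h.+1%:R).
  have [z2 z2P] := near_int_sin (2 * alpha * h'.+1%:R).
  exists (z1 - z2).
  have -> : 2 * alpha * n%:R - (z1 - z2)%:~R
    = (2 * alpha * h.+1%:R - z1%:~R) - (2 * alpha * h'.+1%:R - z2%:~R).
    by rewrite intrB e -addSn natrD; ring.
  have := ler_normB (2 * alpha * h.+1%:R - z1%:~R) (2 * alpha * h'.+1%:R - z2%:~R).
  by rewrite -/k -/u in hB h'B *; nra.
have [j [h [h' [/andP[j0 jJ] hB h'B e]]]] := difference_multiple HU2 cB.
rewrite muln1 in e; have [z zP] := near _ _ _ hB h'B e.
exists (2 * j)%N, z; split; first by lia.
have -> : (2 * j)%:R * alpha = 2 * alpha * j%:R by rewrite natrM; ring.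
set zeta := `|_| in zP *; rewrite leNgt; apply/negP => zbig.
have z0 : 0 < zeta.
  rewrite lt_neqAle normr_ge0 andbT; apply: contraTneq zbig => <-.
  by rewrite mul0r -leNgt mulr_ge0 // exprn_ge0 //; lra.
(* [i0] is the least multiplier for which [i0 * zeta] exceeds the tolerance [16 * k ^+ 2 / u]; as
   [zeta] is below that tolerance, the excess is at most a factor 2. *)
set tr := Num.truncn (16 * k ^+ 2 / (u * zeta)).
have i0E : tr.+1%:R = tr%:R + 1 :> R by rewrite -natr1.
set i0 := tr.+1 in i0E.
have uz0 : 0 < u * zeta by rewrite mulr_gt0.
have i0P : 16 * k ^+ 2 < i0%:R * (u * zeta).
  by rewrite -ltr_pdivrMr // truncnS_gt.
have i0P' : i0%:R * (u * zeta) <= 32 * k ^+ 2.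
  have : tr%:R * (u * zeta) <= 16 * k ^+ 2.
    by rewrite -ler_pdivlMr // truncn_le // divr_ge0 ?(ltW uz0) // mulr_ge0 // sqr_ge0.
  by rewrite i0E mulrDl mul1r => ?; lra.
have jk : j%:R <= 8 * k ^+ 2 by rewrite /k -natrX -natrM ler_nat.
(* The constant [2048 = 32 * 64] is chosen so that the step [i0 * j] is short enough for the second
   pigeonhole. *)
have i0u : 64 * k ^+ 4 * i0%:R <= u.
  have : i0%:R * (2048 * k ^+ 6) <= 32 * k ^+ 2 * u.
    apply: le_trans (_ : _ <= i0%:R * (zeta * u ^+ 2)) _; first by rewrite ler_wpM2l // ltW.
    by nra.
  have -> : k ^+ 6 = k ^+ 4 * k ^+ 2 by ring.
  have k2 : 0 < k ^+ 2 by nra.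
  by move=> ?; rewrite -(ler_pM2r k2); lra.
have dU : (8 * H ^ 2 * (i0 * j) <= U)%N.
  rewrite -(ler_nat R) -/u; apply: le_trans i0u.
  have -> : (8 * H ^ 2 * (i0 * j))%:R = 8 * k ^+ 2 * (i0%:R * j%:R) by rewrite /k !natrM; ring.
  have -> : 64 * k ^+ 4 * i0%:R = 8 * k ^+ 2 * (i0%:R * (8 * k ^+ 2)) by ring.
  by rewrite !ler_wpM2l // mulr_ge0 ?sqr_ge0.
have [j' [g [g' [/andP[j'0 j'J] gB g'B e']]]] := difference_multiple dU cB.
have [z' z'P] := near _ _ _ gB g'B e'.
pose c : R := (j' * i0)%:R.
pose zc : int := z' - z * (j' * i0)%:Z.
pose zs := 2 * alpha * j%:R - z%:~R.
have cE : 2 * alpha * (j' * (i0 * j))%:R - z'%:~R = c * zs - zc%:~R.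
  by rewrite /zc /c /zs intrB intrM -[(j' * i0)%:Z%:~R]/((j' * i0)%:R : R) !natrM; ring.
rewrite {}cE in z'P.
have czs : `|c * zs| = c * zeta by rewrite normrM ger0_norm.
have c1 : i0%:R <= c by rewrite /c natrM ler_peMl // ler1n.
have c2 : c * (u * zeta) <= 256 * k ^+ 4.
  have : j'%:R <= 8 * k ^+ 2 by rewrite /k -natrX -natrM ler_nat.
  rewrite /c natrM => ?; apply: le_trans (_ : _ <= 8 * k ^+ 2 * (32 * k ^+ 2)) _; last by nra.
  by rewrite -mulrA; apply: ler_pM => //; rewrite mulr_ge0 // ltW.
(* The two errors are at most [256 * k ^+ 4 / u] and [16 * k ^+ 4 / u], and [272 * k ^+ 4 <= u], so
   the integer [zc] is less than 1 in absolute value. *)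
have zc0 : zc = 0.
  apply/eqP; rewrite -absz_eq0 -leqn0 -ltnS -(ltr_nat R) natr_absz intr_norm.
  have : `|zc%:~R| <= `|c * zs| + `|c * zs - zc%:~R|.
    by have := ler_normB (c * zs) (c * zs - zc%:~R); rewrite opprB addrCA subrr addr0.
  rewrite czs -(ltr_pM2r U0) => ?.
  have : k ^+ 2 <= k ^+ 4.
    have -> : k ^+ 4 = k ^+ 2 * k ^+ 2 by ring.
    by rewrite ler_peMl ?sqr_ge0 //; nra.
  by nra.
rewrite zc0 subr0 czs in z'P.
suff : 16 * k ^+ 2 < c * zeta * u by lra.
apply: lt_le_trans i0P _; rewrite -mulrA [zeta * u]mulrC.
by rewrite ler_wpM2r // ltW.
Qed.

End Weyl.

(** * Integral relations and rational approximation *)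

(** Irrationality removes the exact case that the definition permits, the exponent is rounded up to
    a natural number, and negative [q] follow by symmetry. *)
Lemma irrational_non_liouville (R : realType) (x : R) :
  irrational x -> non_liouville x ->
  exists (c : R) (k : nat), 0 < c /\
    forall a q : int, q != 0 -> c <= `|q%:~R * x - a%:~R| * `|q%:~R| ^+ k.
Proof.
move=> xirr [c [M [c0 M1 nl]]]; exists c, (Num.truncn M).+1; split=> // a q q0.
wlog q1 : a q q0 / 1 <= q => [H|].
  have [/H|q_lt1] := leP 1 q; first exact.
  have {}H := H (- a) (- q); rewrite !intrN mulNr -opprD !normrN in H; apply: H.
    by rewrite oppr_eq0.
  by move: q0 q_lt1; lia.
have qR : (1 : R) <= q%:~R by rewrite ler1z.
have q0R : (0 : R) < q%:~R by lra.
have qx : `|q%:~R * x - a%:~R| = q%:~R * `|x - a%:~R / q%:~R|.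
  have -> : q%:~R * x - a%:~R = q%:~R * (x - a%:~R / q%:~R) by field; rewrite gt_eqF.
  by rewrite normrM (gtr0_norm q0R).
have pos : 0 < `|x - a%:~R / q%:~R|.
  rewrite normr_gt0 subr_eq0; apply/eqP => xE; apply: xirr.
  by exists (a%:Q / q%:Q) => //; rewrite fmorph_div /= !ratr_int -xE.
rewrite (gtr0_norm q0R) qx.
have := nl a q q1 => /negP; rewrite pos /= -leNgt => h.
have qM : (0 : R) < q%:~R `^ M by rewrite powR_gt0.
rewrite ler_pdivrMr // in h; apply: le_trans h _.
rewrite -mulrA mulrCA ler_wpM2l // -exprS.
rewrite -powR_mulrn ?(ltW q0R) // ler_powR //.
by apply: le_trans (ltW (truncnS_gt M)) _; rewrite ler_nat.
Qed.

(* [W11, W12, W22] are the entries of [B U B^T] where [U] is the symmetric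
   matrix with entries [u1, u2, u3] and [B] has rows [(m, b)] and [(p, a)]; the
   relation says that [W12 = 0], so that [W11 W22 = det U] is small while
   [W22 + beta^2 W11] is tiny. *)
Lemma unimodular_relation_trivial (R : realType) (beta c T : R) (k : nat)
    (m a b p u1 u2 u3 : int) :
  (forall x q : int, q != 0 -> c <= `|q%:~R * beta ^+ 2 - x%:~R| * `|q%:~R| ^+ k) ->
  m * a - b * p = 1 -> 0 < b ->
  `|p%:~R - beta * m%:~R| * b%:~R <= 2 -> `|a%:~R - beta * b%:~R| * b%:~R <= 2 ->
  `|u1%:~R| <= T -> `|u2%:~R| <= T -> `|u3%:~R| <= T ->
  u1 * (m * p) + u2 * (m * a + b * p) + u3 * (b * a) = 0 ->
  16 * T < b%:~R ^+ 2 -> 16 * T < beta ^+ 2 * b%:~R ^+ 2 ->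
  16 * T * (2 * T ^+ 2) ^+ k < c * b%:~R ^+ 2 ->
  [/\ u1 = 0, u2 = 0 & u3 = 0].
Proof.
move=> dioph det b0 hp ha T1 T2 T3 rel Tb Tbeta Tc.
have T0 : 0 <= T by apply: le_trans T1.
set W12 := _ + _ in rel.
pose W11 := u1 * m ^+ 2 + 2 * u2 * m * b + u3 * b ^+ 2.
pose W22 := u1 * p ^+ 2 + 2 * u2 * p * a + u3 * a ^+ 2.
have detW : W11 * W22 = u1 * u3 - u2 ^+ 2.
  have : W11 * W22 - W12 ^+ 2 = (u1 * u3 - u2 ^+ 2) * (m * a - b * p) ^+ 2.
    by rewrite /W11 /W22 /W12; ring.
  by rewrite det rel expr1n mulr1 expr0n subr0.
have bR : (0 : R) < b%:~R by rewrite ltr0z.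
set B : R := b%:~R in bR hp ha Tb Tbeta Tc *.
(* The form with matrix [U] at [(dp, da)] equals [W22 - 2 beta W12 + beta^2 W11], and both arguments
   are at most [2 / b]. *)
have small : `|W22%:~R + beta ^+ 2 * W11%:~R| * B ^+ 2 <= 16 * T.
  set dp := p%:~R - beta * m%:~R in hp; set da := a%:~R - beta * B in ha.
  have -> : W22%:~R + beta ^+ 2 * W11%:~R
     = u1%:~R * dp ^+ 2 + 2 * u2%:~R * dp * da + u3%:~R * da ^+ 2 :> R.
    have -> : W22%:~R + beta ^+ 2 * W11%:~R = W22%:~R + beta ^+ 2 * W11%:~R - 2 * beta * W12%:~R :> R.
      by rewrite rel mulr0 subr0.
    rewrite /W11 /W22 /W12 /dp /da /B.
    ring.
  rewrite -[B ^+ 2]gtr0_norm ?exprn_gt0 // -normrM.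
  have -> : (u1%:~R * dp ^+ 2 + 2 * u2%:~R * dp * da + u3%:~R * da ^+ 2) * B ^+ 2
    = u1%:~R * (dp * B) ^+ 2 + 2 * u2%:~R * (dp * B) * (da * B) + u3%:~R * (da * B) ^+ 2 by ring.
  have hp' : `|dp * B| <= 2 by rewrite normrM (gtr0_norm bR).
  have ha' : `|da * B| <= 2 by rewrite normrM (gtr0_norm bR).
  have prodle (x y z : R) : `|x| <= T -> `|y| <= 2 -> `|z| <= 2 -> `|x * (y * z)| <= 4 * T.
    move=> hx hy hz; rewrite !normrM.
    have -> : 4 * T = T * (2 * 2) by ring.
    by rewrite !ler_pM // mulr_ge0.
  have h1 := prodle _ _ _ T1 hp' hp'; have h2 := prodle _ _ _ T2 hp' ha'.
  have h3 := prodle _ _ _ T3 ha' ha'.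
  apply: le_trans (ler_normD _ _) _.
  apply: le_trans (lerD (ler_normD _ _) (lexx _)) _.
  have -> : 2 * u2%:~R * (dp * B) * (da * B) = 2 * (u2%:~R * (dp * B * (da * B))) by ring.
  by rewrite [ `|2 * _|]normrM [ `|2|]ger0_norm // !expr2; lra.
have BB : 0 < B ^+ 2 by rewrite exprn_gt0.
(* Otherwise [- W22 / W11] approximates [beta ^+ 2] too well: [W22] is then nonzero too, so [W11] is
   bounded by the determinant [W11 * W22], of size at most [2 * T ^+ 2]. *)
have W110 : W11 = 0.
  apply/eqP; apply: contraT => W11n; have W11R : 1 <= `|W11%:~R : R|.
    by rewrite -intr_norm ler1z -gtz0_ge1 normr_gt0.
  have W22n : W22 != 0.
    apply: contraTneq Tbeta => W22E; rewrite -leNgt; apply: le_trans small.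
    rewrite W22E add0r normrM (ger0_norm (sqr_ge0 _)).
    by rewrite (ler_wpM2r (ltW BB)) // ler_peMr ?sqr_ge0.
  have W22R : 1 <= `|W22%:~R : R|.
    by rewrite -intr_norm ler1z -gtz0_ge1 normr_gt0.
  have W11le : `|W11%:~R : R| <= 2 * T ^+ 2.
    have : `|W11%:~R * W22%:~R : R| <= 2 * T ^+ 2.
      rewrite -intrM detW intrB intrM rmorphXn /=; apply: le_trans (ler_normB _ _) _.
      rewrite normrM normrX expr2 mulr_natl mulr2n; apply: lerD; first by rewrite ler_pM.
      by rewrite ler_pM.
    by rewrite normrM; apply: le_trans; rewrite ler_peMr.
  have := dioph (- W22) W11 W11n; rewrite intrN opprK.
  rewrite [_ * beta ^+ 2]mulrC addrC => h.
  suff : c * B ^+ 2 <= 16 * T * (2 * T ^+ 2) ^+ k by rewrite leNgt Tc.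
  apply: le_trans (_ : _ <= `|W22%:~R + beta ^+ 2 * W11%:~R| * B ^+ 2 * `|W11%:~R| ^+ k) _.
    by rewrite mulrAC ler_pM2r.
  apply: ler_pM => //; [by rewrite mulr_ge0 ?(ltW BB) | exact: exprn_ge0 |].
  by apply: lerXn2r => //; rewrite nnegrE // mulr_ge0 ?sqr_ge0.
have W220 : W22 = 0.
  apply/eqP; apply: contraT => W22n; have : 1 <= `|W22%:~R : R|.
    by rewrite -intr_norm ler1z -gtz0_ge1 normr_gt0.
  rewrite W110 mulr0 addr0 in small => W22R.
  have : B ^+ 2 <= `|W22%:~R| * B ^+ 2 by rewrite ler_peMl // ltW.
  by move=> h; have := le_lt_trans (le_trans h small) Tb; rewrite ltxx.
(* The congruence by the unimodular matrix is inverted to recover [u1], [u2], [u3] from the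
   vanishing entries. *)
split.
- have : u1 * (m * a - b * p) ^+ 2 = a ^+ 2 * W11 - 2 * a * b * W12 + b ^+ 2 * W22.
    by rewrite /W11 /W22 /W12; ring.
  by rewrite det rel W110 W220 expr1n mulr1 !mulr0 subr0 addr0.
- have : u2 * (m * a - b * p) ^+ 2 = - a * p * W11 + (a * m + b * p) * W12 - b * m * W22.
    by rewrite /W11 /W22 /W12; ring.
  by rewrite det rel W110 W220 expr1n mulr1 !mulr0 subr0 addr0.
- have : u3 * (m * a - b * p) ^+ 2 = p ^+ 2 * W11 - 2 * p * m * W12 + m ^+ 2 * W22.
    by rewrite /W11 /W22 /W12; ring.
  by rewrite det rel W110 W220 expr1n mulr1 !mulr0 subr0 addr0.
Qed.

(** The multiplier [t] cancels from the cross product, leaving only the two rounding errors. *)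
Lemma cross_product_le (R : realType) (t E V : R) (v1 v2 w1 w2 : int) :
  `|t * v1%:~R - w1%:~R| <= E -> `|t * v2%:~R - w2%:~R| <= E ->
  `|v1%:~R| <= V -> `|v2%:~R| <= V -> `|(v1 * w2 - v2 * w1)%:~R| <= 2 * E * V.
Proof.
move=> h1 h2 V1 V2; rewrite intrB !intrM.
have -> : v1%:~R * w2%:~R - v2%:~R * w1%:~R
  = v2%:~R * (t * v1%:~R - w1%:~R) - v1%:~R * (t * v2%:~R - w2%:~R) by ring.
apply: le_trans (ler_normB _ _) _; rewrite !normrM.
have -> : 2 * E * V = V * E + V * E by ring.
by apply: lerD; apply: ler_pM.
Qed.

(** The cross product of [v] and [w] is orthogonal to [v], hence an integral relation of size at
    most [T]. It must be trivial, so [w] is a multiple [s v] and the last coordinate gives the bound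
    on [t - s]. *)
Lemma near_multiple (R : realType) (beta c t E V : R) (k : nat)
    (m a b p w1 w2 w3 : int) :
  (forall x q : int, q != 0 -> c <= `|q%:~R * beta ^+ 2 - x%:~R| * `|q%:~R| ^+ k) ->
  m * a - b * p = 1 -> 0 < b ->
  `|p%:~R - beta * m%:~R| * b%:~R <= 2 -> `|a%:~R - beta * b%:~R| * b%:~R <= 2 ->
  `|(m * p)%:~R| <= V -> `|(m * a + b * p)%:~R| <= V -> `|(b * a)%:~R| <= V ->
  `|t * (m * p)%:~R - w1%:~R| <= E -> `|t * (m * a + b * p)%:~R - w2%:~R| <= E ->
  `|t * (b * a)%:~R - w3%:~R| <= E ->
  let T := 2 * E * V in
  16 * T < b%:~R ^+ 2 -> 16 * T < beta ^+ 2 * b%:~R ^+ 2 ->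
  16 * T * (2 * T ^+ 2) ^+ k < c * b%:~R ^+ 2 ->
  exists s : int, `|t - s%:~R| * `|(b * a)%:~R| <= E.
Proof.
move=> dioph det b0 hp ha V1 V2 V3 h1 h2 h3 T Tb Tbeta Tc.
set v1 := m * p in V1 h1; set v2 := m * a + b * p in V2 h2; set v3 := b * a in V3 h3 *.
have c1 := cross_product_le h2 h3 V2 V3; have c2 := cross_product_le h3 h1 V3 V1.
have c3 := cross_product_le h1 h2 V1 V2.
have rel : (v2 * w3 - v3 * w2) * v1 + (v3 * w1 - v1 * w3) * v2 + (v1 * w2 - v2 * w1) * v3 = 0 by ring.
have [e1 e2 e3] := unimodular_relation_trivial dioph det b0 hp ha c1 c2 c3 rel Tb Tbeta Tc.
(* The multiplier is read off from the discriminant identity [v2 ^+ 2 - 4 * v1 * v3 = 1], which also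
   expresses that [v] is primitive. *)
exists (w2 * v2 - 4 * w1 * v3).
have disc : v2 ^+ 2 - 4 * v1 * v3 = 1.
  have -> : v2 ^+ 2 - 4 * v1 * v3 = (m * a - b * p) ^+ 2 by rewrite /v1 /v2 /v3; ring.
  by rewrite det.
have w3E : (w2 * v2 - 4 * w1 * v3) * v3 = w3.
  have -> : (w2 * v2 - 4 * w1 * v3) * v3 = w3 * (v2 ^+ 2 - 4 * v1 * v3)
     - v2 * (v2 * w3 - v3 * w2) - 4 * v3 * (v3 * w1 - v1 * w3) by ring.
  by rewrite disc e1 e2 !mulr0 !subr0 mulr1.
by rewrite -normrM mulrBl -intrM w3E.
Qed.

(** * Complete sums *)

Section CompleteSums.
Context {R : realType}.

(** An affine map of determinant 1 permutes the pairs of residues modulo [q]; injectivity is checked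
    with the adjugate matrix. *)
Lemma sum_unimodular_residues (q : nat) (m a b p x y : int) (phi : int -> int -> R) :
  (forall x y z, phi (x + z * q%:Z) y = phi x y) ->
  (forall x y z, phi x (y + z * q%:Z) = phi x y) ->
  m * a - b * p = 1 ->
  \sum_(i < q) \sum_(j < q) phi (x + i%:Z * m + j%:Z * b) (y + i%:Z * p + j%:Z * a)
  = \sum_(i < q) \sum_(j < q) phi i%:Z j%:Z.
Proof.
case: q => [|q] px py det; first by rewrite !big_ord0.
pose res (z : int) : 'I_q.+1 := inord `|(z %% q.+1%:Z)%Z|%N.
have resE z : (res z : nat)%:Z = (z %% q.+1%:Z)%Z.
  have z0 : (0 <= z %% q.+1%:Z)%Z by rewrite modz_ge0.
  have zq : (z %% q.+1%:Z < q.+1%:Z)%Z by rewrite ltz_pmod.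
  by rewrite /res inordK ?gez0_abs // -ltz_nat gez0_abs.
rewrite !pair_big /=.
pose h (ij : 'I_q.+1 * 'I_q.+1) :=
  (res (x + ij.1%:Z * m + ij.2%:Z * b), res (y + ij.1%:Z * p + ij.2%:Z * a)).
have hinj : injective h.
  move=> [i j] [i' j'] [] /(congr1 (fun z : 'I_q.+1 => (z : nat)%:Z)).
  rewrite !resE /= => /eqP; rewrite eqz_mod_dvd => d1.
  move=> /(congr1 (fun z : 'I_q.+1 => (z : nat)%:Z)).
  rewrite !resE /= => /eqP; rewrite eqz_mod_dvd => d2.
  have small (k k' : 'I_q.+1) : (q.+1%:Z %| k%:Z - k'%:Z)%Z -> k = k'.
    rewrite -eqz_mod_dvd !modz_small ?ltz_nat ?ltn_ord //.
    by move=> /eqP [] /val_inj.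
  congr (_, _); apply: small.
    have -> : i%:Z - i'%:Z = a * (x + i%:Z * m + j%:Z * b - (x + i'%:Z * m + j'%:Z * b))
       - b * (y + i%:Z * p + j%:Z * a - (y + i'%:Z * p + j'%:Z * a)).
      rewrite -[LHS]mul1r -[in LHS]det; ring.
    by rewrite rpredB ?dvdz_mull.
  have -> : j%:Z - j'%:Z = m * (y + i%:Z * p + j%:Z * a - (y + i'%:Z * p + j'%:Z * a))
     - p * (x + i%:Z * m + j%:Z * b - (x + i'%:Z * m + j'%:Z * b)).
    rewrite -[LHS]mul1r -[in LHS]det; ring.
  by rewrite rpredB ?dvdz_mull.
rewrite [RHS](reindex_inj hinj); apply: eq_bigr => -[i j] _ /=; rewrite !resE.
set X := x + _ + _; set Y := y + _ + _.
rewrite [in LHS](divz_eq X q.+1%:Z) [in LHS](divz_eq Y q.+1%:Z).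
by rewrite addrC px addrC py.
Qed.

Definition gauss_sum (s : int) (q : nat) : R :=
  \sum_(i < q) \sum_(j < q) ecos (s%:~R / q%:R * (i%:Z * j%:Z)%:~R).

Lemma row_sum_ecos (s : int) (q : nat) (i : nat) : (0 < q)%N ->
  \sum_(j < q) ecos (s%:~R / q%:R * (i%:Z * j%:Z)%:~R : R)
  = \sum_(j < q) ecos ((s * i%:Z)%:~R / q%:R * j%:R : R).
Proof. by move=> q0; apply: eq_bigr => j _; congr ecos; rewrite !intrM -![(Posz _)%:~R]/(_%:R); ring. Qed.

(** Each row runs over all residues of a linear phase, so it is either 0 or a sum of ones. *)
Lemma gauss_sum_ge0 (s : int) (q : nat) : (0 < q)%N -> 0 <= gauss_sum s q.
Proof.
move=> q0; apply: sumr_ge0 => i _; rewrite row_sum_ecos //.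
have [qsi|nqsi] := boolP (q %| s * i%:Z)%Z; last by rewrite sum_ecos_root.
apply: sumr_ge0 => j _; case/dvdzP: qsi => z ->.
have -> : (z * q)%:~R / q%:R * j%:R = (z * j%:Z)%:~R :> R.
  rewrite !intrM -![(Posz _)%:~R]/(_%:R : R) mulfK //.
  by rewrite pnatr_eq0 -lt0n.
by rewrite ecosz.
Qed.

Lemma gauss_sum_le (s : int) (q : nat) : gauss_sum s q <= q%:R ^+ 2.
Proof.
have -> : q%:R ^+ 2 = \sum_(i < q) \sum_(j < q) 1 :> R.
  by rewrite !sumr_const !card_ord expr2 mulr_natr.
apply: ler_sum => i _; apply: ler_sum => j _.
exact: le_trans (ler_norm _) (ecos_le1 _).
Qed.

Lemma sum_esin_gauss (s : int) (q : nat) : (0 < q)%N ->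
  \sum_(i < q) \sum_(j < q) esin (s%:~R / q%:R * (i%:Z * j%:Z)%:~R : R) = 0.
Proof.
move=> q0; apply: big1 => i _; rewrite -[RHS](sum_esin_root (s * i%:Z) q0).
by apply: eq_bigr => j _; congr esin; rewrite !intrM -![(Posz _)%:~R]/(_%:R); ring.
Qed.

(** The change of basis leaves the form [x y]; in the addition formula the sine part vanishes row by
    row, so the phase [c] factors out. *)
Lemma complete_sum (s : int) (q : nat) (m a b p x y : int) (c : R) : (0 < q)%N ->
  m * a - b * p = 1 ->
  \sum_(i < q) \sum_(j < q)
    ecos (s%:~R / q%:R * ((x + i%:Z * m + j%:Z * b) * (y + i%:Z * p + j%:Z * a))%:~R + c)
  = gauss_sum s q * ecos c.
Proof.
move=> q0 det.
have q0R : (q%:R : R) != 0 by rewrite pnatr_eq0 -lt0n.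
have per1 (u v z : int) : s%:~R / q%:R * ((u + z * q%:Z) * v)%:~R
     = s%:~R / q%:R * (u * v)%:~R + (s * z * v)%:~R :> R.
  by rewrite !(intrM, intrD) -![(Posz _)%:~R]/(_%:R : R); field.
have per2 (u v z : int) : s%:~R / q%:R * (u * (v + z * q%:Z))%:~R
     = s%:~R / q%:R * (u * v)%:~R + (s * z * u)%:~R :> R.
  by rewrite [u * (v + _)]mulrC per1 [v * u]mulrC.
rewrite (@sum_unimodular_residues q m a b p x y
   (fun u v => ecos (s%:~R / q%:R * (u * v)%:~R + c))) //; last 2 first.
- by move=> u v z; rewrite per1 addrAC ecosDz.
- by move=> u v z; rewrite per2 addrAC ecosDz.
transitivity (gauss_sum s q * ecos c -
   (\sum_(i < q) \sum_(j < q) esin (s%:~R / q%:R * (i%:Z * j%:Z)%:~R)) * esin c).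
  rewrite /gauss_sum !mulr_suml -sumrB; apply: eq_bigr => i _.
  by rewrite !mulr_suml -sumrB; apply: eq_bigr => j _; rewrite ecosD.
by rewrite sum_esin_gauss // mul0r subr0.
Qed.

(** A shift by one exchanges a single term at each end, at a cost of at most [2 * B]. *)
Lemma sum_shift_le (n i : nat) (B : R) (f : nat -> R) : (forall k, `|f k| <= B) ->
  `|\sum_(k < n) f (k + i)%N - \sum_(k < n) f k| <= 2 * i%:R * B.
Proof.
move=> fB; elim: i => [|i IH].
  under eq_bigr do rewrite addn0.
  by rewrite subrr normr0 mulr0 mul0r.
have step : \sum_(k < n) f (k + i.+1)%N = \sum_(k < n) f (k + i)%N + (f (n + i)%N - f i).
  have : \sum_(k < n.+1) f (k + i)%N = \sum_(k < n.+1) f (k + i)%N by [].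
  rewrite {1}big_ord_recl big_ord_recr /= add0n.
  have -> : \sum_(k < n) f (bump 0 k + i)%N = \sum_(k < n) f (k + i.+1)%N.
    by apply: eq_bigr => k _; rewrite /bump add1n addSnnS.
  by move=> h; rewrite addrA -h; ring.
rewrite step addrAC -[i.+1%:R]natr1 mulrDr mulr1 mulrDl.
apply: le_trans (ler_normD _ _) _; apply: lerD => //.
apply: le_trans (ler_normB _ _) _; have := fB i; have := fB (n + i)%N; lra.
Qed.

Lemma ler_norm_sum_const (n : nat) (B : R) (f : nat -> R) :
  (forall k, (k < n)%N -> `|f k| <= B) -> `|\sum_(k < n) f k| <= n%:R * B.
Proof.
move=> fB; apply: le_trans (ler_norm_sum _ _ _) _.
rewrite -[n in n%:R]card_ord mulr_natl -sumr_const; apply: ler_sum => i _; exact: fB.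
Qed.

Lemma sum_shift2_le (n i j : nat) (f : nat -> nat -> R) : (forall k l, `|f k l| <= 1) ->
  `|\sum_(k < n) \sum_(l < n) f (k + i)%N (l + j)%N - \sum_(k < n) \sum_(l < n) f k l|
   <= 2 * (i + j)%:R * n%:R.
Proof.
move=> f1.
have -> : \sum_(k < n) \sum_(l < n) f (k + i)%N (l + j)%N - \sum_(k < n) \sum_(l < n) f k l
  = (\sum_(k < n) \sum_(l < n) f (k + i)%N (l + j)%N - \sum_(k < n) \sum_(l < n) f k (l + j)%N)
  + \sum_(k < n) (\sum_(l < n) f k (l + j)%N - \sum_(l < n) f k l).
  by rewrite sumrB; ring.
rewrite natrD mulrDr mulrDl; apply: le_trans (ler_normD _ _) _; apply: lerD.
  apply: (@sum_shift_le n i n%:R (fun k => \sum_(l < n) f k (l + j)%N)) => k.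
  rewrite -[n%:R]mulr1; apply: (@ler_norm_sum_const n 1 (fun l => f k (l + j)%N)) => l _.
  exact: f1.
rewrite mulrC; apply: (@ler_norm_sum_const n _
   (fun k => \sum_(l < n) f k (l + j)%N - \sum_(l < n) f k l)) => k _.
by rewrite -[leRHS]mulr1; apply: (@sum_shift_le n j 1 (f k)).
Qed.

(* Near a rational [s / q] the sum over a box factors, by averaging over all
   translates by [(i, j)] with [i, j < q], which run through all residues. *)
Lemma box_sum_major_arc (eta Delta : R) (s : int) (q U : nat) (m a b p x y : int) :
  (0 < q)%N -> m * a - b * p = 1 ->
  let F (u v : nat) : int := (x + u%:Z * m + v%:Z * b) * (y + u%:Z * p + v%:Z * a) in
  (forall u v i j, (u < U)%N -> (v < U)%N -> (i < q)%N -> (j < q)%N ->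
     `|(F (u + i)%N (v + j)%N)%:~R - (F u v)%:~R| <= Delta) ->
  `|q%:R ^+ 2 * \sum_(u < U) \sum_(v < U) ecos ((s%:~R / q%:R + eta) * (F u v)%:~R)
    - gauss_sum s q * \sum_(u < U) \sum_(v < U) ecos (eta * (F u v)%:~R)|
  <= q%:R ^+ 2 * (4 * q%:R * U%:R + 8 * U%:R ^+ 2 * `|eta| * Delta).
Proof.
move=> q0 det F FD.
set S := \sum_(u < U) _; set S0 := \sum_(u < U) \sum_(v < U) ecos (eta * _).
pose f (u v : nat) := ecos ((s%:~R / q%:R + eta) * (F u v)%:~R).
pose A := \sum_(i < q) \sum_(j < q) \sum_(u < U) \sum_(v < U) f (u + i)%N (v + j)%N.
have sum_q2 (c : R) : \sum_(i < q) \sum_(j < q) c = q%:R ^+ 2 * c.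
  by rewrite !sumr_const !card_ord expr2 -mulrA !mulr_natl.
(* A translate by less than [q] in each direction alters the box sum only along its boundary. *)
have h1 : `|q%:R ^+ 2 * S - A| <= q%:R ^+ 2 * (4 * q%:R * U%:R).
  rewrite distrC -sum_q2 -sum_q2 /A -sumrB.
  apply: le_trans (ler_norm_sum _ _ _) _; apply: ler_sum => i _.
  rewrite -sumrB; apply: le_trans (ler_norm_sum _ _ _) _; apply: ler_sum => j _.
  have -> : S = \sum_(k < U) \sum_(l < U) f k l by [].
  apply: le_trans (sum_shift2_le _ _ _ _) _; first by move=> k l; exact: ecos_le1.
  rewrite ler_wpM2r // -natrM -natrM ler_nat; have := ltn_ord i; have := ltn_ord j; lia.
have AE : A = \sum_(u < U) \sum_(v < U) \sum_(i < q) \sum_(j < q) f (u + i)%N (v + j)%N.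
  rewrite /A; under eq_bigr do rewrite exchange_big /=.
  rewrite exchange_big /=; apply: eq_bigr => u _.
  under eq_bigr do rewrite exchange_big /=.
  by rewrite exchange_big.
(* At a fixed base point [(u, v)] the part [eta * F] of the phase is frozen, at a cost of
   [8 * Delta] times the size of [eta] for each term; the rest is a complete sum. *)
have h2 : `|A - gauss_sum s q * S0| <= q%:R ^+ 2 * (8 * U%:R ^+ 2 * `|eta| * Delta).
  rewrite AE mulr_sumr -sumrB.
  have -> : q%:R ^+ 2 * (8 * U%:R ^+ 2 * `|eta| * Delta)
     = U%:R * (U%:R * (q%:R * (q%:R * (8 * `|eta| * Delta)))) by ring.
  apply: (@ler_norm_sum_const U _ (fun u => \sum_(v < U) \sum_(i < q) \sum_(j < q) f (u + i)%N (v + j)%N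
       - gauss_sum s q * \sum_(v < U) ecos (eta * (F u v)%:~R))) => u uU.
  rewrite mulr_sumr -sumrB.
  apply: (@ler_norm_sum_const U _ (fun v => \sum_(i < q) \sum_(j < q) f (u + i)%N (v + j)%N
       - gauss_sum s q * ecos (eta * (F u v)%:~R))) => v vU.
  pose x' := x + u%:Z * m + v%:Z * b; pose y' := y + u%:Z * p + v%:Z * a.
  pose e (i j : nat) := ecos (s%:~R / q%:R *
     ((x' + i%:Z * m + j%:Z * b) * (y' + i%:Z * p + j%:Z * a))%:~R + eta * (F u v)%:~R).
  rewrite -(complete_sum s x' y' _ q0 det) -sumrB.
  apply: (@ler_norm_sum_const q _ (fun i => \sum_(j < q) f (u + i)%N (v + j)%N
       - \sum_(j < q) e i j)) => i iq.
  rewrite -sumrB.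
  apply: (@ler_norm_sum_const q _ (fun j => f (u + i)%N (v + j)%N - e i j)) => j jq.
  apply: le_trans (ecos_lipschitz _ _) _; rewrite -[leRHS]mulrA ler_wpM2l //.
  have -> : (x' + i%:Z * m + j%:Z * b) * (y' + i%:Z * p + j%:Z * a) = F (u + i)%N (v + j)%N.
    by rewrite /F /x' /y' !PoszD; ring.
  have -> : (s%:~R / q%:R + eta) * (F (u + i)%N (v + j)%N)%:~R -
     (s%:~R / q%:R * (F (u + i)%N (v + j)%N)%:~R + eta * (F u v)%:~R)
    = eta * ((F (u + i)%N (v + j)%N)%:~R - (F u v)%:~R) by ring.
  by rewrite normrM ler_wpM2l //; apply: FD.
rewrite mulrDr.
have -> : q%:R ^+ 2 * S - gauss_sum s q * S0 = (q%:R ^+ 2 * S - A) + (A - gauss_sum s q * S0) by ring.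
by apply: le_trans (ler_normD _ _) _; apply: lerD.
Qed.

End CompleteSums.

(** * Fejer weights on squares *)

Section Fejer.
Context {R : realType}.

(** This one-sided sum is half of the Fejer kernel, a squared modulus, plus [Z / 2]. *)
Lemma fejer_ge0 (c : R) (Z : nat) : 0 <= \sum_(z < Z) (Z%:R - z%:R) * ecos (c * z%:R).
Proof.
have sq : 0 <= \sum_(s < Z) \sum_(t < Z) ecos (c * s%:R - c * t%:R).
  have -> : \sum_(s < Z) \sum_(t < Z) ecos (c * s%:R - c * t%:R)
     = (\sum_(s < Z) ecos (c * s%:R)) ^+ 2 + (\sum_(s < Z) esin (c * s%:R)) ^+ 2.
    rewrite !expr2 !big_distrlr /= -big_split; apply: eq_bigr => s _ /=.
    by rewrite -big_split; apply: eq_bigr => t _; rewrite ecosB.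
  by rewrite addr_ge0 ?sqr_ge0.
rewrite (sum_square_symmetric (G := fun s t => ecos (c * s%:R - c * t%:R))) in sq; last first.
  by move=> s t; rewrite -ecosN opprB.
case: Z sq => [|Z] sq; first by rewrite big_ord0.
move: sq; under eq_bigr do rewrite subrr ecos0.
rewrite sumr_const card_ord [\sum_(h < Z.+1) _]big_ord_recr /= subnn big_ord0 addr0.
rewrite big_ord_recl /= subr0 mulr0 ecos0 mulr1.
have -> : \sum_(h < Z) \sum_(t < Z.+1 - h.+1) ecos (c * (t + h.+1)%:R - c * t%:R)
  = \sum_(i < Z) (Z.+1%:R - (bump 0 i)%:R) * ecos (c * (bump 0 i)%:R).
  apply: eq_bigr => h _; rewrite /bump leq0n add1n -natrB; last by have := ltn_ord h; lia.
  rewrite -[in LHS](card_ord (Z.+1 - h.+1)) mulr_natl -[in RHS](card_ord (Z.+1 - h.+1)) -sumr_const.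
  by rewrite card_ord; apply: eq_bigr => t _; congr ecos; rewrite natrD; ring.
by have := ler0n R Z.+1; lra.
Qed.

(** Cuts the range at the squares, so that each [z] can be compared with the largest square [j ^ 2]
    below it. *)
Lemma sum_square_blocks (f : nat -> R) (L : nat) :
  \sum_(z < L ^ 2) f z = \sum_(j < L) \sum_(i < j.*2.+1) f (j ^ 2 + i)%N.
Proof.
elim: L => [|L IH]; first by rewrite !big_ord0.
rewrite [RHS]big_ord_recr /= -IH.
have -> : (L.+1 ^ 2 = L ^ 2 + L.*2.+1)%N by lia.
by rewrite big_split_ord.
Qed.

(** Closed form of the total Fejer weight [L^2 - z] over the block [j^2 <= z < (j + 1)^2]. *)
Definition fejer_weight (L : nat) (j : nat) : R :=
  (2 * j%:R + 1) * (L%:R ^+ 2 - j%:R ^+ 2 - j%:R).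

Definition fejer_mass (L : nat) : R := \sum_(j < L) fejer_weight L j.

Lemma fejer_weightE (L j : nat) :
  fejer_weight L j = \sum_(i < j.*2.+1) ((L ^ 2)%:R - (j ^ 2 + i)%:R).
Proof.
have sum_id (n : nat) (x : R) : 2 * \sum_(i < n) (x - i%:R) = n%:R * (2 * x - n%:R + 1).
  elim: n => [|n IH]; first by rewrite big_ord0; ring.
  by rewrite big_ord_recr /= mulrDr IH -[n.+1%:R]natr1; ring.
apply: (@mulfI _ 2); first by rewrite pnatr_eq0.
have -> : \sum_(i < j.*2.+1) ((L ^ 2)%:R - (j ^ 2 + i)%:R)
  = \sum_(i < j.*2.+1) (((L ^ 2)%:R - (j ^ 2)%:R) - i%:R) :> R.
  by apply: eq_bigr => i _; rewrite natrD; ring.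
rewrite sum_id -[j.*2.+1%:R]natr1 -muln2 natrM !natrX /fejer_weight; ring.
Qed.

Lemma fejer_massE (L : nat) : 2 * fejer_mass L = L%:R ^+ 2 * (L%:R ^+ 2 + 1).
Proof.
have gen (n : nat) : 2 * \sum_(j < n) fejer_weight L j
     = n%:R ^+ 2 * (2 * L%:R ^+ 2 - n%:R ^+ 2 + 1).
  elim: n => [|n IH]; first by rewrite big_ord0; ring.
  by rewrite big_ord_recr /= mulrDr IH -[n.+1%:R]natr1 /fejer_weight; ring.
by rewrite gen; ring.
Qed.

Lemma fejer_mass_ge (L : nat) : L%:R ^+ 4 <= 2 * fejer_mass L.
Proof. by rewrite fejer_massE; have := sqr_ge0 (L%:R : R); nra. Qed.

Lemma fejer_mass_ge0 (L : nat) : 0 <= fejer_mass L.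
Proof. by have := fejer_mass_ge L; have := @exprn_ge0 R 4 _ (ler0n _ L); lra. Qed.

Lemma fejer_weight_ge0 (L j : nat) : (j < L)%N -> 0 <= fejer_weight L j.
Proof.
move=> jL; rewrite fejer_weightE; apply: sumr_ge0 => i _; rewrite subr_ge0 ler_nat.
have := ltn_ord i; have : (j.+1 ^ 2 <= L ^ 2)%N by rewrite leq_sqr.
have -> : (j.+1 ^ 2 = j ^ 2 + j.*2.+1)%N by lia.
  lia.
Qed.

(** Comparison with the Fejer kernel of length [L ^ 2]: moving [z] down to the square starting its
    block changes it by at most [2 * L], and the Lipschitz constant 8 gives the factor 16. *)
Lemma fejer_squares_ge (c : R) (L : nat) :
  - (16 * `|c| * L%:R * fejer_mass L) <= \sum_(j < L) fejer_weight L j * ecos (c * j%:R ^+ 2).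
Proof.
have := fejer_ge0 c (L ^ 2).
rewrite (sum_square_blocks (fun z => ((L ^ 2)%:R - z%:R) * ecos (c * z%:R))).
rewrite /fejer_mass mulr_sumr -subr_ge0 => pos; rewrite -subr_ge0 opprK.
apply: le_trans pos _; rewrite subr0 -big_split /=; apply: ler_sum => j _.
rewrite fejer_weightE mulr_sumr mulr_suml -big_split /=; apply: ler_sum => i _.
have w0 : 0 <= (L ^ 2)%:R - (j ^ 2 + i)%:R :> R.
  rewrite subr_ge0 ler_nat.
  have := ltn_ord i; have : (j.+1 ^ 2 <= L ^ 2)%N by rewrite leq_sqr.
  have -> : (j.+1 ^ 2 = j ^ 2 + j.*2.+1)%N by lia.
  lia.
rewrite [16 * _ * _ * _]mulrC -mulrDr ler_wpM2l //.
have := ecos_lipschitz (c * (j ^ 2 + i)%:R) (c * j%:R ^+ 2).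
rewrite -mulrBr natrD natrX.
have -> : j%:R ^+ 2 + i%:R - j%:R ^+ 2 = i%:R :> R by ring.
rewrite normrM => h.
have iL : `|i%:R| <= 2 * L%:R :> R.
  rewrite ger0_norm // -natrM ler_nat; have := ltn_ord i; have := ltn_ord j; lia.
have : 8 * (`|c| * `|i%:R|) <= 16 * `|c| * L%:R.
  have -> : 16 * `|c| * L%:R = 8 * (`|c| * (2 * L%:R)) by ring.
  by rewrite !ler_wpM2l.
have := ler_norm (ecos (c * (j%:R ^+ 2 + i%:R)) - ecos (c * j%:R ^+ 2)).
lra.
Qed.

(** Summation by parts: consecutive weights differ by at most [6 * L ^ 2], and the two end terms are
    at most [2 * L ^ 2] and [L ^ 2]. *)
Lemma fejer_weight_step (L : nat) (g : nat -> R) : (forall k, `|g k| <= 1) ->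
  `|\sum_(j < L) fejer_weight L j * g j.+1 - \sum_(j < L) fejer_weight L j * g j|
    <= 9 * L%:R ^+ 3.
Proof.
move=> g1; case: L => [|L]; first by rewrite !big_ord0 subrr normr0 expr0n mulr0.
have L1 : (1 : R) <= L.+1%:R by rewrite ler1n.
rewrite big_ord_recr big_ord_recl /=.
have -> : \sum_(i < L) fejer_weight L.+1 i * g i.+1 + fejer_weight L.+1 L * g L.+1
   - (fejer_weight L.+1 0 * g 0%N + \sum_(i < L) fejer_weight L.+1 (bump 0 i) * g (bump 0 i))
  = fejer_weight L.+1 L * g L.+1 - fejer_weight L.+1 0 * g 0%N
    + \sum_(i < L) (fejer_weight L.+1 i - fejer_weight L.+1 i.+1) * g i.+1.
  rewrite opprD !addrA; under [in RHS]eq_bigr do rewrite mulrBl.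
  by rewrite sumrB; ring.
have mulg (x y : R) k : `|x| <= y -> `|x * g k| <= y.
  by move=> xy; rewrite normrM; apply: le_trans xy; rewrite ler_piMr.
set l : R := L.+1%:R in L1 *.
have b1 : `|fejer_weight L.+1 L * g L.+1| <= 2 * l ^+ 2.
  apply: mulg; rewrite /fejer_weight -/l.
  have -> : L%:R = l - 1 :> R by rewrite /l -natr1 addrK.
  have -> : (2 * (l - 1) + 1) * (l ^+ 2 - (l - 1) ^+ 2 - (l - 1)) = (2 * l - 1) * l by ring.
  by rewrite ger0_norm; nra.
have b0 : `|fejer_weight L.+1 0 * g 0%N| <= l ^+ 2.
  by apply: mulg; rewrite /fejer_weight -/l mulr0 add0r mul1r expr0n !subr0 ger0_norm ?sqr_ge0.
have bs : `|\sum_(i < L) (fejer_weight L.+1 i - fejer_weight L.+1 i.+1) * g i.+1|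
    <= l * (6 * l ^+ 2).
  apply: le_trans (ler_norm_sum _ _ _) _.
  apply: le_trans (_ : _ <= \sum_(i < L) 6 * l ^+ 2) _.
    apply: ler_sum => i _; apply: mulg; rewrite /fejer_weight -/l.
    have iL : i.+1%:R <= l by rewrite ler_nat; have := ltn_ord i; lia.
    have -> : i%:R = i.+1%:R - 1 :> R by rewrite -natr1 addrK.
    set x : R := i.+1%:R in iL *; have x0 : 0 <= x by [].
    have -> : (2 * (x - 1) + 1) * (l ^+ 2 - (x - 1) ^+ 2 - (x - 1)) -
       (2 * x + 1) * (l ^+ 2 - x ^+ 2 - x) = 6 * x ^+ 2 - 2 * l ^+ 2 by ring.
    have xl : x ^+ 2 <= l ^+ 2 by nra.
    have x2 : 0 <= x ^+ 2 by rewrite sqr_ge0.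
    by rewrite ler_norml; apply/andP; split; lra.
  rewrite sumr_const card_ord -[leLHS]mulr_natl ler_wpM2r ?mulr_ge0 ?sqr_ge0 //.
  by rewrite ler_nat.
apply: le_trans (ler_normD _ _) _; apply: le_trans (lerD (ler_normB _ _) (lexx _)) _.
have : l ^+ 2 <= l ^+ 3 by rewrite -[l ^+ 2]mul1r exprS ler_wpM2r ?sqr_ge0.
have e : l * (6 * l ^+ 2) = 6 * l ^+ 3 by ring.
by rewrite e in bs; lra.
Qed.

Lemma fejer_weight_shift (L i : nat) (g : nat -> R) : (forall k, `|g k| <= 1) ->
  `|\sum_(j < L) fejer_weight L j * g (j + i)%N - \sum_(j < L) fejer_weight L j * g j|
    <= i%:R * (9 * L%:R ^+ 3).
Proof.
move=> g1; elim: i => [|i IH].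
  by under eq_bigr do rewrite addn0; rewrite subrr normr0 mul0r.
have st : `|\sum_(j < L) fejer_weight L j * g (j + i.+1)%N
    - \sum_(j < L) fejer_weight L j * g (j + i)%N| <= 9 * L%:R ^+ 3.
  have := @fejer_weight_step L (fun k => g (k + i)%N) (fun k => g1 _).
  by under eq_bigr do rewrite addSnnS.
rewrite -[i.+1%:R]natr1 mulrDl mul1r.
rewrite -(subrK (\sum_(j < L) fejer_weight L j * g (j + i)%N)
  (\sum_(j < L) fejer_weight L j * g (j + i.+1)%N)) -addrA.
by apply: le_trans (ler_normD _ _) _; rewrite [leRHS]addrC; apply: lerD.
Qed.

(** Three losses in turn: replacing [f j] by an exact multiple of a square, undoing the shift by
    [i], and the defect of the Fejer sum over squares. *)
Lemma weighted_sum_ge (L i : nat) (c D : R) (f : nat -> R) :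
  (forall j, (j < L)%N -> `|f j - c * (j + i)%:R ^+ 2| <= D) ->
  - (8 * D * fejer_mass L + i%:R * (9 * L%:R ^+ 3) + 16 * `|c| * L%:R * fejer_mass L)
   <= \sum_(j < L) fejer_weight L j * ecos (f j).
Proof.
move=> fD.
have h1 : \sum_(j < L) fejer_weight L j * ecos (c * (j + i)%:R ^+ 2) - 8 * D * fejer_mass L
   <= \sum_(j < L) fejer_weight L j * ecos (f j).
  rewrite /fejer_mass mulr_sumr -sumrB; apply: ler_sum => j _.
  rewrite [8 * D * _]mulrC -mulrBr ler_wpM2l ?fejer_weight_ge0 //.
  have := ecos_lipschitz (c * (j + i)%:R ^+ 2) (f j).
  have := ler_norm (ecos (c * (j + i)%:R ^+ 2) - ecos (f j)).
  rewrite [X in 8 * X]distrC; have := fD j (ltn_ord j); lra.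
have := @fejer_weight_shift L i (fun k => ecos (c * k%:R ^+ 2)) (fun k => ecos_le1 _).
have := fejer_squares_ge c L.
rewrite ler_norml => h2 /andP[h3 _]; lra.
Qed.

End Fejer.

(** * The kernel on the strip *)

(* [(m, p)] and [(b, a)] form a basis of [Z^2] adapted to the strip
   [0 <= beta x - y < 1]; its points [(x, y)] satisfy [y = floor (beta x)], and
   [(n0, y0)] is chosen in the middle of the strip. *)
Record adapted_basis (R : realType) (beta : R) (b : nat) (m a p n0 y0 : int) : Prop :=
  AdaptedBasis {
    basis_det : m * a - b%:Z * p = 1;
    basis_m : 0 <= m <= b%:Z;
    basis_approx : `|a%:~R - beta * b%:R| * b%:R <= 1;
    basis_origin : n0 * a - b%:Z * y0 = (b %/ 2)%N;
    basis_n0 : b%:Z <= n0 < (2 * b)%N }.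

Section Kernel.
Context {R : realType} (beta : R) (b : nat) (m a p n0 y0 : int).

Definition xpt (k l : nat) : int := n0 + k%:Z * m + l%:Z * b%:Z.
Definition ypt (k l : nat) : int := y0 + k%:Z * p + l%:Z * a.

(** With the other variables fixed, [u] moves the point along [(m, p)], [v] along [(b, a)] and [s]
    along their sum: one free variable for each use of Weyl's inequality. The variable [j] carries
    the Fejer weights, along [(b, a)]. *)
Definition kernel (L U : nat) (theta : R) : R :=
  \sum_(j < L) fejer_weight L j * \sum_(s < U) \sum_(u < U) \sum_(v < U)
    ecos (theta * (xpt (u + s) (j + s + v) * ypt (u + s) (j + s + v))%:~R).

Context (basis : adapted_basis beta b m a p n0 y0).

Lemma b_gt0 : (0 < b)%N.
Proof. by have /andP[h1 h2] := basis_n0 basis; have := le_lt_trans h1 h2; lia. Qed.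

Lemma b_ge1R : (1 : R) <= b%:R.
Proof. by rewrite ler1n b_gt0. Qed.

(** The determinant gives [b (p - beta m) = m (a - beta b) - 1], and [m <= b]. *)
Lemma basis_approx_p : `|p%:~R - beta * m%:~R| * b%:R <= 2.
Proof.
have b1 := b_ge1R; have bapp := basis_approx basis.
have -> : `|p%:~R - beta * m%:~R| * b%:R = `|m%:~R * (a%:~R - beta * b%:R) - 1|.
  rewrite -[b%:R in LHS]ger0_norm // -normrM; congr `|_|.
  by have /(congr1 (fun z : int => z%:~R : R)) := basis_det basis; rewrite intrB !intrM; lra.
apply: le_trans (ler_normB _ _) _; rewrite normr1 normrM.
have /andP[m0 mb] := basis_m basis.
have mb' : `|m%:~R| <= b%:R :> R by rewrite ger0_norm ?ler0z // -[b%:R]/(b%:Z%:~R) ler_int.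
have := @ler_wpM2r R _ (normr_ge0 (a%:~R - beta * b%:R)) _ _ mb'.
by rewrite [b%:R * _]mulrC; lra.
Qed.

Lemma xpt_ge0 (k l : nat) : 0 <= xpt k l.
Proof.
have /andP[m0 mb] := basis_m basis; have /andP[n1 n2] := basis_n0 basis.
by rewrite /xpt !addr_ge0 ?mulr_ge0 //; apply: le_trans n1.
Qed.

Lemma xpt_le (k l : nat) : ((xpt k l)%:~R : R) <= (2 + k + l)%:R * b%:R.
Proof.
have /andP[m0 mb] := basis_m basis; have /andP[n1 n2] := basis_n0 basis.
have : xpt k l <= (2 + k + l)%N%:Z * b%:Z.
  by rewrite /xpt; have : k%:Z * m <= k%:Z * b%:Z by [rewrite ler_wpM2l]; lia.
by rewrite -(ler_int R) intrM.
Qed.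

Lemma ypt_xpt (k l : nat) : xpt k l * a - b%:Z * ypt k l = (b %/ 2 + k)%N.
Proof.
have -> : xpt k l * a - b%:Z * ypt k l = (n0 * a - b%:Z * y0) + k%:Z * (m * a - b%:Z * p).
  by rewrite /xpt /ypt; ring.
by rewrite (basis_origin basis) (basis_det basis) mulr1.
Qed.

(** Position of the point across the strip, scaled by [b]: an integer starting at the middle, up to
    a defect bounded by [2 + k + l] in [xpt_defect_le]. *)
Lemma strip_eq (k l : nat) :
  (beta * (xpt k l)%:~R - (ypt k l)%:~R) * b%:R
  = (b %/ 2 + k)%:R - (xpt k l)%:~R * (a%:~R - beta * b%:R).
Proof.
have /(congr1 (fun z : int => z%:~R : R)) := ypt_xpt k l.
rewrite intrB !intrM -![(Posz _)%:~R]/(_%:R); lra.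
Qed.

Lemma xpt_defect_le (N k l : nat) : (2 + k + l <= N)%N ->
  `|(xpt k l)%:~R * (a%:~R - beta * b%:R)| <= N%:R.
Proof.
move=> klN; have b1 := b_ge1R; have h := xpt_le k l; have bapp := basis_approx basis.
have x0 : (0 : R) <= (xpt k l)%:~R by rewrite ler0z xpt_ge0.
rewrite normrM (ger0_norm x0).
have klN' : (2 + k + l)%:R <= N%:R :> R by rewrite ler_nat.
set d := `|_| in bapp *; have d0 : 0 <= d by exact: normr_ge0.
have : (xpt k l)%:~R <= N%:R * b%:R :> R by apply: le_trans h _; rewrite ler_wpM2r.
move=> /(ler_wpM2r d0) /le_trans; apply.
rewrite -mulrA [b%:R * d]mulrC -[leRHS]mulr1 ler_wpM2l //.
Qed.

(** The strip has scaled width [b], so fewer than [b / 4] steps from its middle cannot leave it. *)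
Lemma ypt_floor (k l : nat) : (4 * (3 + k + l) <= b)%N ->
  Num.floor (beta * (xpt k l)%:~R) = ypt k l.
Proof.
move=> klb; have b1 := b_ge1R.
have := xpt_defect_le (leqnn (2 + k + l)); rewrite ler_norml => /andP[h1 h2].
have E := strip_eq k l.
apply: floor_def; rewrite intrD.
have lo : (2 + k + l)%:R <= (b %/ 2 + k)%:R :> R by rewrite ler_nat; lia.
have hi : (b %/ 2 + k)%:R + (2 + k + l)%:R < b%:R :> R by rewrite -natrD ltr_nat; lia.
have b0 : (0 : R) < b%:R by lra.
set D := (beta * _ - _) in E.
have D0 : 0 <= D * b%:R by rewrite E; lra.
have D1 : D * b%:R < 1 * b%:R by rewrite E; lra.
rewrite pmulr_lge0 // in D0; rewrite ltr_pM2r // in D1.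
by rewrite /D in D0 D1; apply/andP; split; lra.
Qed.

Lemma ypt_near (k l : nat) : (2 + k + l <= b)%N -> (2 * k <= b)%N ->
  `|(ypt k l)%:~R - beta * (xpt k l)%:~R| <= 2.
Proof.
move=> klb kb; have b1 := b_ge1R; have E := strip_eq k l.
have b0 : (0 : R) < b%:R by lra.
rewrite -(ler_pM2r b0) distrC -{1}(gtr0_norm b0) -normrM E.
apply: le_trans (ler_normB _ _) _; have := xpt_defect_le klb.
have : `|(b %/ 2 + k)%:R| <= b%:R :> R.
  rewrite ger0_norm // ler_nat; lia.
lra.
Qed.

Context (K : R) (K_ge : `|beta| + 2 <= K).

Lemma K_gt0 : 0 < K.
Proof. by apply: lt_le_trans K_ge; have := normr_ge0 beta; lra. Qed.

Lemma basis_a_le : `|a%:~R| <= K * b%:R.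
Proof.
have b1 := b_ge1R; have bapp := basis_approx basis; have bp := normr_ge0 beta.
have d0 := normr_ge0 (a%:~R - beta * b%:R).
have -> : a%:~R = (a%:~R - beta * b%:R) + beta * b%:R :> R by ring.
apply: le_trans (ler_normD _ _) _; rewrite normrM (ger0_norm (ler0n _ b)).
have : `|a%:~R - beta * b%:R| <= b%:R by nra.
have : (`|beta| + 2) * b%:R <= K * b%:R by rewrite ler_wpM2r.
lra.
Qed.

Lemma basis_p_le : `|p%:~R| <= K * b%:R.
Proof.
have b1 := b_ge1R; have bapp := basis_approx_p; have bp := normr_ge0 beta.
have d0 := normr_ge0 (p%:~R - beta * m%:~R).
have /andP[m0 mb] := basis_m basis.
have mb' : `|m%:~R| <= b%:R :> R by rewrite ger0_norm ?ler0z // -[b%:R]/(b%:Z%:~R) ler_int.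
have -> : p%:~R = (p%:~R - beta * m%:~R) + beta * m%:~R :> R by ring.
apply: le_trans (ler_normD _ _) _; rewrite normrM.
have : `|p%:~R - beta * m%:~R| <= 2 * b%:R by nra.
have : `|beta| * `|m%:~R| <= `|beta| * b%:R by rewrite ler_wpM2l.
have : (`|beta| + 2) * b%:R <= K * b%:R by rewrite ler_wpM2r.
lra.
Qed.

Lemma xpt_le_sqr (k l : nat) : (2 + k + l <= b)%N -> ((xpt k l)%:~R : R) <= b%:R ^+ 2.
Proof.
by move=> klb; apply: le_trans (xpt_le k l) _; rewrite expr2 ler_wpM2r // ler_nat.
Qed.

Lemma ypt_le (k l : nat) : (2 + k + l <= b)%N -> (2 * k <= b)%N ->
  `|(ypt k l)%:~R| <= K * b%:R ^+ 2.
Proof.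
move=> klb kb; have b1 := b_ge1R; have h := ypt_near klb kb; have bp := normr_ge0 beta.
have x1 := xpt_le_sqr klb; have x0 : (0 : R) <= (xpt k l)%:~R by rewrite ler0z xpt_ge0.
have -> : (ypt k l)%:~R = ((ypt k l)%:~R - beta * (xpt k l)%:~R) + beta * (xpt k l)%:~R by ring.
apply: le_trans (ler_normD _ _) _; rewrite normrM (ger0_norm x0).
have b2 : 1 <= b%:R ^+ 2 :> R by rewrite expr_ge1.
have : (`|beta| + 2) * b%:R ^+ 2 <= K * b%:R ^+ 2 by rewrite ler_wpM2r // sqr_ge0.
have : `|beta| * (xpt k l)%:~R <= `|beta| * b%:R ^+ 2 by rewrite ler_wpM2l.
lra.
Qed.

(** Supplies the variation bound [Delta] of [box_sum_major_arc]. *)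
Lemma point_product_variation (q k l i j : nat) :
  (2 + k + l + 2 * q <= b)%N -> (2 * k <= b)%N -> (i < q)%N -> (j < q)%N ->
  `|(xpt (k + i) (l + j) * ypt (k + i) (l + j))%:~R - (xpt k l * ypt k l)%:~R|
    <= 4 * q%:R * K * b%:R ^+ 3.
Proof.
move=> klb kb iq jq; have K0 := K_gt0; have b0 : (0 : R) <= b%:R by [].
have /andP[m0 mb] := basis_m basis.
have mb' : `|m%:~R| <= b%:R :> R by rewrite ger0_norm ?ler0z // -[b%:R]/(b%:Z%:~R) ler_int.
have iq' : i%:R <= q%:R :> R by rewrite ler_nat ltnW.
have jq' : j%:R <= q%:R :> R by rewrite ler_nat ltnW.
have Y := @ypt_le k l ltac:(lia) kb.
have X : `|(xpt (k + i) (l + j))%:~R| <= b%:R ^+ 2 :> R.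
  rewrite ger0_norm ?ler0z ?xpt_ge0 //; apply: xpt_le_sqr; lia.
have lin (c d C : R) : `|c| <= C -> `|d| <= C -> `|i%:R * c + j%:R * d| <= 2 * q%:R * C.
  move=> hc hd; apply: le_trans (ler_normD _ _) _; rewrite !normrM !(ger0_norm (ler0n _ _)).
  have -> : 2 * q%:R * C = q%:R * C + q%:R * C by ring.
  by apply: lerD; apply: ler_pM.
have dX : `|i%:R * m%:~R + j%:R * b%:R| <= 2 * q%:R * b%:R :> R.
  by apply: lin => //; rewrite ger0_norm.
have dY := lin _ _ _ basis_p_le basis_a_le.
have -> : (xpt (k + i) (l + j) * ypt (k + i) (l + j))%:~R - (xpt k l * ypt k l)%:~R
  = (i%:R * m%:~R + j%:R * b%:R) * (ypt k l)%:~R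
   + (xpt (k + i) (l + j))%:~R * (i%:R * p%:~R + j%:R * a%:~R) :> R.
  by rewrite /xpt /ypt !PoszD; ring.
apply: le_trans (ler_normD _ _) _; rewrite !normrM.
have -> : 4 * q%:R * K * b%:R ^+ 3 = 2 * q%:R * b%:R * (K * b%:R ^+ 2)
    + b%:R ^+ 2 * (2 * q%:R * (K * b%:R)) by ring.
by apply: lerD; apply: ler_pM.
Qed.

(** As [y] is close to [beta x], and [x] exceeds [(l + t %/ b) * b] by less than [b], the product is
    nearly a fixed multiple of a square, the shape for which the Fejer weights are made. *)
Lemma point_product_square (k l : nat) (t : nat) :
  (2 + k + l <= b)%N -> (2 * k <= b)%N -> n0 + k%:Z * m = t%:Z ->
  `|(xpt k l * ypt k l)%:~R - beta * b%:R ^+ 2 * (l + t %/ b)%:R ^+ 2|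
    <= 4 * K * b%:R ^+ 3.
Proof.
move=> klb kb tE; have K0 := K_gt0; have b1 := b_ge1R.
have X2 := xpt_le_sqr klb; have X0 : (0 : R) <= (xpt k l)%:~R by rewrite ler0z xpt_ge0.
have Y := ypt_near klb kb.
have XE : (xpt k l)%:~R = (l + t %/ b)%:R * b%:R + (t %% b)%:R :> R.
  rewrite /xpt tE intrD intrM -![(Posz _)%:~R]/(_%:R : R) {1}(divn_eq t b).
  by rewrite !natrD natrM; ring.
set X := (xpt k l)%:~R in X2 X0 Y XE *; set J := (l + t %/ b)%:R in XE *.
have r0 : (0 : R) <= (t %% b)%:R by [].
have rb : (t %% b)%:R <= b%:R :> R by rewrite ler_nat ltnW // ltn_mod b_gt0.
set r := (t %% b)%:R in r0 rb XE.
have J0 : 0 <= J by exact: ler0n.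
rewrite intrM -/X.
have -> : X * (ypt k l)%:~R - beta * b%:R ^+ 2 * J ^+ 2
  = X * ((ypt k l)%:~R - beta * X) + beta * (r * (X + J * b%:R)).
  by rewrite XE; ring.
apply: le_trans (ler_normD _ _) _; rewrite ![ `|_ * _|]normrM (ger0_norm X0) (ger0_norm r0).
have JX : J * b%:R <= X by rewrite XE; lra.
have JX0 : 0 <= X + J * b%:R by rewrite addr_ge0 // mulr_ge0.
rewrite (ger0_norm JX0).
have h1 : X * `|(ypt k l)%:~R - beta * X| <= b%:R ^+ 2 * 2 by apply: ler_pM.
have h2 : r * (X + J * b%:R) <= b%:R * (2 * b%:R ^+ 2) by apply: ler_pM => //; lra.
have h3 : `|beta| * (r * (X + J * b%:R)) <= K * (b%:R * (2 * b%:R ^+ 2)).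
  by apply: ler_pM => //; [rewrite mulr_ge0|have := K_ge; lra].
have h4 : b%:R ^+ 2 <= b%:R ^+ 3 :> R by rewrite [leRHS]exprS ler_peMl ?sqr_ge0.
have h5 : b%:R ^+ 2 * 2 <= K * b%:R ^+ 3.
  rewrite mulrC; apply: ler_pM => //; rewrite ?sqr_ge0 //.
  by have := K_ge; have := normr_ge0 beta; lra.
have h6 : 0 <= K * b%:R ^+ 3 by rewrite mulr_ge0 ?exprn_ge0 // ltW.
lra.
Qed.

Lemma kernel_exchange (L U : nat) (theta : R) : kernel L U theta =
  \sum_(s < U) \sum_(u < U) \sum_(v < U) \sum_(j < L) fejer_weight L j *
    ecos (theta * (xpt (u + s) (j + s + v) * ypt (u + s) (j + s + v))%:~R).
Proof.
rewrite /kernel; under eq_bigr do rewrite mulr_sumr.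
rewrite exchange_big; apply: eq_bigr => s _ /=; under eq_bigr do rewrite mulr_sumr.
rewrite exchange_big; apply: eq_bigr => u _ /=; under eq_bigr do rewrite mulr_sumr.
by rewrite exchange_big.
Qed.

Lemma sum3_const (U : nat) (c : R) : \sum_(s < U) \sum_(u < U) \sum_(v < U) c = U%:R ^+ 3 * c.
Proof. by rewrite !sumr_const !card_ord -!mulrnA -[LHS]mulr_natl !natrM; ring. Qed.

(** For fixed [s], [u], [v] the sum over [j] is a Fejer sum over squares, shifted by at most
    [6 * U]. *)
Lemma kernel_near0_ge (L U : nat) (eta : R) : (0 < U)%N -> (2 + L + 4 * U <= b)%N ->
  - (U%:R ^+ 3 * (8 * (`|eta| * (4 * K * b%:R ^+ 3)) * fejer_mass L
      + (6 * U)%:R * (9 * L%:R ^+ 3) + 16 * `|eta * (beta * b%:R ^+ 2)| * L%:R * fejer_mass L))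
   <= kernel L U eta.
Proof.
move=> U0 LUb; rewrite kernel_exchange -mulrN -sum3_const.
apply: ler_sum => s _; apply: ler_sum => u _; apply: ler_sum => v _.
have ltS := ltn_ord s; have ltu := ltn_ord u; have ltv := ltn_ord v.
have /andP[m0 mb] := basis_m basis; have /andP[n1 n2] := basis_n0 basis.
pose t : nat := absz (n0 + (u + s)%N%:Z * m).
have tE : n0 + (u + s)%N%:Z * m = t%:Z.
  by rewrite /t gez0_abs // addr_ge0 ?mulr_ge0 // (le_trans _ n1).
have tb : (t %/ b <= 2 * U)%N.
  rewrite -ltnS ltn_divLR ?b_gt0 // -ltz_nat -tE.
  have : (u + s)%N%:Z * m <= (u + s)%N%:Z * b%:Z by rewrite ler_wpM2l.
  have : ((u + s) * b <= (2 * U - 2) * b)%N by rewrite leq_mul2r; apply/orP; right; lia.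
  rewrite -PoszM; have -> : ((2 * U - 2) * b = 2 * U * b - 2 * b)%N by rewrite mulnBl.
  have : (2 * b <= 2 * U * b)%N by rewrite -mulnA leq_pmul2l // leq_pmull.
  by rewrite mulSn; lia.
have i6 : (s + v + t %/ b <= 6 * U)%N by lia.
apply: le_trans (@weighted_sum_ge R L (s + v + t %/ b) (eta * (beta * b%:R ^+ 2))
   (`|eta| * (4 * K * b%:R ^+ 3)) (fun j => eta * (xpt (u + s) (j + s + v) * ypt (u + s) (j + s + v))%:~R) _).
  rewrite lerN2 lerD2r lerD2l ler_wpM2r ?mulr_ge0 ?exprn_ge0 //.
  by rewrite ler_nat.
move=> j jL; rewrite -mulrA -mulrBr normrM ler_wpM2l //.
have -> : (j + (s + v + t %/ b) = (j + s + v) + t %/ b)%N by lia.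
apply: point_product_square => //; lia.
Qed.

(** Box by box, [q ^+ 2] times the kernel is close to [gauss_sum s q] times the kernel at [eta]. The
    Gauss sum lies between 0 and [q ^+ 2], so the lower bound [- B] survives the division. *)
Lemma kernel_major_arc_ge (L U q : nat) (s : int) (eta B : R) :
  (0 < q)%N -> (2 + L + 4 * U + 2 * q <= b)%N -> 0 <= B -> - B <= kernel L U eta ->
  - (B + fejer_mass L * (U%:R * (4 * q%:R * U%:R + 8 * U%:R ^+ 2 * `|eta| * (4 * q%:R * K * b%:R ^+ 3))))
   <= kernel L U (s%:~R / q%:R + eta).
Proof.
move=> q0 LUb B0 kB; set e := 4 * q%:R * U%:R + _.
have q2 : (0 : R) < q%:R ^+ 2 by rewrite exprn_gt0 // ltr0n.
have key : `|q%:R ^+ 2 * kernel L U (s%:~R / q%:R + eta) - gauss_sum s q * kernel L U eta|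
    <= q%:R ^+ 2 * (fejer_mass L * (U%:R * e)).
  rewrite /kernel !mulr_sumr -sumrB /fejer_mass mulr_suml mulr_sumr.
  apply: le_trans (ler_norm_sum _ _ _) _; apply: ler_sum => j _.
  set Bt := \sum_(s0 < U) _; set B0' := \sum_(s0 < U) _.
  have -> : q%:R ^+ 2 * (fejer_weight L j * Bt) - gauss_sum s q * (fejer_weight L j * B0')
    = fejer_weight L j * (q%:R ^+ 2 * Bt - gauss_sum s q * B0') by ring.
  have -> : q%:R ^+ 2 * (fejer_weight L j * (U%:R * e))
    = fejer_weight L j * (U%:R * (q%:R ^+ 2 * e)) by ring.
  rewrite normrM ger0_norm ?fejer_weight_ge0 // ler_wpM2l ?fejer_weight_ge0 //.
  rewrite /Bt /B0' !mulr_sumr -sumrB.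
  apply: (@ler_norm_sum_const R U _ (fun r => q%:R ^+ 2 * \sum_(u < U) \sum_(v < U)
     ecos ((s%:~R / q%:R + eta) * (xpt (u + r) (j + r + v) * ypt (u + r) (j + r + v))%:~R)
     - gauss_sum s q * \sum_(u < U) \sum_(v < U)
     ecos (eta * (xpt (u + r) (j + r + v) * ypt (u + r) (j + r + v))%:~R))) => r rU.
  have FE (u v : nat) : xpt (u + r) (j + r + v) * ypt (u + r) (j + r + v)
     = (xpt r (j + r) + u%:Z * m + v%:Z * b%:Z) * (ypt r (j + r) + u%:Z * p + v%:Z * a).
    by rewrite /xpt /ypt !PoszD; ring.
  under eq_bigr do under eq_bigr do rewrite FE.
  under [X in gauss_sum s q * X]eq_bigr do under eq_bigr do rewrite FE.
  apply: box_sum_major_arc => //; first exact: basis_det basis.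
  move=> u v i' j' uU vU iq jq; rewrite -!FE.
  have -> : (u + i' + r = u + r + i')%N by lia.
  have -> : (j + r + (v + j') = j + r + v + j')%N by lia.
  have jL := ltn_ord j.
  apply: point_product_variation => //; lia.
rewrite ler_norml in key; case/andP: key => key _.
have G0 := @gauss_sum_ge0 R s q q0; have Gq := @gauss_sum_le R s q.
have GB : - (q%:R ^+ 2 * B) <= gauss_sum s q * kernel L U eta.
  apply: le_trans (_ : _ <= gauss_sum s q * - B) _; last by rewrite ler_wpM2l.
  by rewrite mulrN lerN2 ler_wpM2r.
by rewrite -(ler_pM2l q2); lra.
Qed.

End Kernel.

(** * Lower bound for the kernel *)

Section MinorArcs.
Context {R : realType}.

Lemma exists_lt_weighted_sum (n : nat) (w f : nat -> R) (c : R) :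
  (forall i, (i < n)%N -> 0 <= w i) ->
  \sum_(i < n) w i * f i < (\sum_(i < n) w i) * c -> exists2 i, (i < n)%N & f i < c.
Proof.
move=> w0 lt_sum; have [/existsP[i fi]|/existsPn nf] := boolP [exists i : 'I_n, f i < c].
  by exists i.
move: lt_sum; rewrite ltNge mulr_suml => /negP[]; apply: ler_sum => i _.
by rewrite ler_wpM2l ?w0 // leNgt nf.
Qed.

Lemma exists_lt_sum (n : nat) (f : nat -> R) (c : R) :
  \sum_(i < n) f i < n%:R * c -> exists2 i, (i < n)%N & f i < c.
Proof.
move=> h; apply: (@exists_lt_weighted_sum n (fun _ => 1)) => //.
under eq_bigr do rewrite mul1r.
by rewrite sumr_const card_ord.
Qed.

Lemma exists_lt_sum3 (U : nat) (f : nat -> nat -> nat -> R) (c : R) :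
  \sum_(s < U) \sum_(u < U) \sum_(v < U) f s u v < U%:R * (U%:R * c) ->
  exists s u, \sum_(v < U) f s u v < c.
Proof.
move=> /(@exists_lt_sum U (fun s => \sum_(u < U) \sum_(v < U) f s u v)) [s _].
by move=> /(@exists_lt_sum U (fun u => \sum_(v < U) f s u v)) [u _ h]; exists s, u.
Qed.

Lemma weyl_line (theta : R) (U H : nat) (x y d e : int) :
  (0 < H)%N -> (272 * H ^ 4 <= U)%N ->
  \sum_(t < U) ecos (theta * ((x + t%:Z * d) * (y + t%:Z * e))%:~R) < - (U%:R / H%:R) ->
  exists (q : nat) (z : int), (0 < q <= 16 * H ^ 2)%N /\
    `|q%:R * (theta * (d * e)%:~R) - z%:~R| * U%:R ^+ 2 <= 2048 * H%:R ^+ 6.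
Proof.
move=> H0 HU small; apply: (@weyl R _ (theta * (x * e + y * d)%:~R) (theta * (x * y)%:~R)) => //.
set S := \sum_(t < U) _ in small; set S' := \sum_(t < U) _.
have <- : S = S'.
  apply: eq_bigr => t _; congr ecos.
  by rewrite !(intrM, intrD) -![(Posz _)%:~R]/(_%:R : R); ring.
have h0 : (0 : R) < H%:R by rewrite ltr0n.
have : U%:R / H%:R <= `|S|.
  by rewrite -normrN; apply: le_trans (ler_norm _); rewrite lerNr; exact: ltW.
by rewrite ler_pdivrMr // mulrC.
Qed.

(** A very negative kernel has, for some [j], a very negative line sum in each of the three
    directions, so Weyl's inequality controls [theta] times [m p], [b a] and [(m + b)(p + a)]. *)
Lemma kernel_minor_arc (theta : R) (b L U H : nat) (m a p n0 y0 : int) :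
  (4096 <= H)%N -> (272 * H ^ 4 <= U)%N ->
  kernel b m a p n0 y0 L U theta < fejer_mass L * (U%:R * (U%:R * - (U%:R / H%:R))) ->
  exists (q : nat) (w1 w2 w3 : int), [/\ (0 < q <= H ^ 7)%N,
    `|q%:R * theta * (m * p)%:~R - w1%:~R| * U%:R ^+ 2 <= H%:R ^+ 12,
    `|q%:R * theta * (m * a + b%:Z * p)%:~R - w2%:~R| * U%:R ^+ 2 <= H%:R ^+ 12 &
    `|q%:R * theta * (b%:Z * a)%:~R - w3%:~R| * U%:R ^+ 2 <= H%:R ^+ 12].
Proof.
move=> H2048 HU.
have third (x y : R) : 0 <= x -> 3 * x <= y -> x <= y by lra.
have thirds (x y z w : R) : 3 * x <= w -> 3 * y <= w -> 3 * z <= w -> x + y + z <= w by lra.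
have H0 : (0 < H)%N by apply: leq_trans H2048.
pose F (j s u v : nat) := ecos (theta *
  (xpt b m n0 (u + s) (j + s + v) * ypt a p y0 (u + s) (j + s + v))%:~R).
move=> klt; have [||j jL kj] := @exists_lt_weighted_sum L (fejer_weight L)
  (fun j => \sum_(s < U) \sum_(u < U) \sum_(v < U) F j s u v) (U%:R * (U%:R * - (U%:R / H%:R))).
- by move=> i iL; exact: fejer_weight_ge0.
- exact: klt.
pose f := F j.
have kv : \sum_(s < U) \sum_(u < U) \sum_(v < U) f s u v < U%:R * (U%:R * - (U%:R / H%:R)) by [].
(* The sums are reordered so that [v], [u] and [s] are innermost in turn. *)
have ku : \sum_(s < U) \sum_(v < U) \sum_(u < U) f s u v < U%:R * (U%:R * - (U%:R / H%:R)).
  by apply: le_lt_trans kv; apply: ler_sum => s _; rewrite exchange_big.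
have ks : \sum_(v < U) \sum_(u < U) \sum_(s < U) f s u v < U%:R * (U%:R * - (U%:R / H%:R)).
  apply: le_lt_trans ku; rewrite [leRHS]exchange_big; apply: ler_sum => v _.
  by rewrite [leRHS]exchange_big.
have [s1 [v1 /= l1]] := @exists_lt_sum3 U (fun s v u => f s u v) _ ku.
have [s3 [u3 /= l3]] := @exists_lt_sum3 U f _ kv.
have [v4 [u4 /= l4]] := @exists_lt_sum3 U (fun v u s => f s u v) _ ks.
have [q1 [z1 [/andP[q10 q1H] h1]]] : exists (q : nat) (z : int), (0 < q <= 16 * H ^ 2)%N /\
    `|q%:R * (theta * (m * p)%:~R) - z%:~R| * U%:R ^+ 2 <= 2048 * H%:R ^+ 6.
  apply: (@weyl_line theta U H (xpt b m n0 s1 (j + s1 + v1)) (ypt a p y0 s1 (j + s1 + v1))) => //.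
  apply: le_lt_trans l1; apply: ler_sum => u _; rewrite le_eqVlt; apply/orP; left; apply/eqP.
  by rewrite /f /F; congr ecos; congr (_ * _%:~R); rewrite /xpt /ypt !PoszD; ring.
have [q3 [z3 [/andP[q30 q3H] h3]]] : exists (q : nat) (z : int), (0 < q <= 16 * H ^ 2)%N /\
    `|q%:R * (theta * (b%:Z * a)%:~R) - z%:~R| * U%:R ^+ 2 <= 2048 * H%:R ^+ 6.
  apply: (@weyl_line theta U H (xpt b m n0 (u3 + s3) (j + s3)) (ypt a p y0 (u3 + s3) (j + s3))) => //.
  apply: le_lt_trans l3; apply: ler_sum => u _; rewrite le_eqVlt; apply/orP; left; apply/eqP.
  by rewrite /f /F; congr ecos; congr (_ * _%:~R); rewrite /xpt /ypt !PoszD; ring.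
have [q4 [z4 [/andP[q40 q4H] h4]]] : exists (q : nat) (z : int), (0 < q <= 16 * H ^ 2)%N /\
    `|q%:R * (theta * ((m + b%:Z) * (p + a))%:~R) - z%:~R| * U%:R ^+ 2 <= 2048 * H%:R ^+ 6.
  apply: (@weyl_line theta U H (xpt b m n0 u4 (j + v4)) (ypt a p y0 u4 (j + v4))) => //.
  apply: le_lt_trans l4; apply: ler_sum => u _; rewrite le_eqVlt; apply/orP; left; apply/eqP.
  by rewrite /f /F; congr ecos; congr (_ * _%:~R); rewrite /xpt /ypt !PoszD; ring.
have h2048 : 4096 <= H%:R :> R by rewrite ler_nat.
set h : R := H%:R in h1 h3 h4 h2048 *; have hpos : 0 < h by rewrite /h ltr0n.
set u2 := U%:R ^+ 2 in h1 h3 h4 *; have u20 : 0 <= u2 by rewrite sqr_ge0.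
have qh (r : nat) : (r <= 16 * H ^ 2)%N -> r%:R <= 16 * h ^+ 2.
  by move=> hr; rewrite /h -natrX -natrM ler_nat.
(* The factor 3 leaves room for the three errors that add up in the middle coordinate. *)
have scale (r r' : nat) (x : R) : (r <= 16 * H ^ 2)%N -> (r' <= 16 * H ^ 2)%N ->
    `|x| * u2 <= 2048 * h ^+ 6 -> 3 * (`|r%:R * r'%:R * x| * u2) <= h ^+ 12.
  move=> /qh rH /qh r'H hx; rewrite normrM ger0_norm ?mulr_ge0 // -[_ * _ * u2]mulrA.
  have h10 : r%:R * r'%:R * (`|x| * u2) <= (16 * h ^+ 2) * (16 * h ^+ 2) * (2048 * h ^+ 6).
    by apply: ler_pM => //; rewrite ?mulr_ge0 //; apply: ler_pM.
  have e1 : (16 * h ^+ 2) * (16 * h ^+ 2) * (2048 * h ^+ 6) = 256 * 2048 * h ^+ 10 by ring.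
  have -> : h ^+ 12 = h * h * h ^+ 10 by ring.
  rewrite {}e1 in h10.
  apply: le_trans (_ : _ <= 768 * 2048 * h ^+ 10) _.
    apply: le_trans (_ : _ <= 3 * (256 * 2048 * h ^+ 10)) _; first by rewrite ler_wpM2l.
    by rewrite !mulrA -natrM.
  by rewrite ler_wpM2r ?exprn_ge0 ?(ltW hpos) // ler_pM //; apply: le_trans h2048; rewrite ler_nat.
have s1' := scale _ _ _ q3H q4H h1; have s3' := scale _ _ _ q1H q4H h3.
have s4' := scale _ _ _ q1H q3H h4.
set e1 := _ - z1%:~R in s1'; set e3 := _ - z3%:~R in s3'; set e4 := _ - z4%:~R in s4'.
(* The common denominator is at most [16 ^ 3 * H ^ 6 <= H ^ 7], by [4096 <= H]. The middle entry
   uses [m a + b p = (m + b)(p + a) - m p - b a]. *)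
exists (q1 * q3 * q4)%N, ((q3 * q4)%N%:Z * z1),
  ((q1 * q3)%N%:Z * z4 - (q3 * q4)%N%:Z * z1 - (q1 * q4)%N%:Z * z3), ((q1 * q4)%N%:Z * z3); split.
- rewrite !muln_gt0 q10 q30 q40 /=; rewrite -(ler_nat R) [leRHS]natrX -/h !natrM.
  have := qh _ q1H; have := qh _ q3H; have := qh _ q4H => r4 r3 r1.
  apply: le_trans (_ : _ <= (16 * h ^+ 2) * (16 * h ^+ 2) * (16 * h ^+ 2)) _.
    by apply: ler_pM => //; rewrite ?mulr_ge0 //; apply: ler_pM.
  have -> : (16 * h ^+ 2) * (16 * h ^+ 2) * (16 * h ^+ 2) = 4096 * h ^+ 6 by ring.
  by rewrite [leRHS]exprS ler_wpM2r ?exprn_ge0 ?(ltW hpos).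
- have -> : (q1 * q3 * q4)%N%:R * theta * (m * p)%:~R - ((q3 * q4)%N%:Z * z1)%:~R = q3%:R * q4%:R * e1.
    by rewrite /e1 !intrM !natrM -![(Posz _)%:~R]/(_%:R : R) !natrM; ring.
  by apply: third s1'; rewrite mulr_ge0.
- have -> : (q1 * q3 * q4)%N%:R * theta * (m * a + b%:Z * p)%:~R
     - ((q1 * q3)%N%:Z * z4 - (q3 * q4)%N%:Z * z1 - (q1 * q4)%N%:Z * z3)%:~R
    = q1%:R * q3%:R * e4 - q3%:R * q4%:R * e1 - q1%:R * q4%:R * e3.
    rewrite /e1 /e3 /e4 !(intrB, intrM, intrD) -![(Posz _)%:~R]/(_%:R : R) !natrM; ring.
  apply: le_trans (_ : _ <= (`|q1%:R * q3%:R * e4| + `|q3%:R * q4%:R * e1| + `|q1%:R * q4%:R * e3|) * u2) _.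
    rewrite ler_wpM2r //; apply: le_trans (ler_normB _ _) _; rewrite lerD2r; exact: ler_normB.
  by rewrite !mulrDl; apply: thirds.
- have -> : (q1 * q3 * q4)%N%:R * theta * (b%:Z * a)%:~R - ((q1 * q4)%N%:Z * z3)%:~R = q1%:R * q4%:R * e3.
    by rewrite /e3 !intrM -![(Posz _)%:~R]/(_%:R : R) !natrM; ring.
  by apply: third s3'; rewrite mulr_ge0.
Qed.

End MinorArcs.

Section KernelBound.
Context {R : realType}.

(** Bookkeeping for the bounds near 0 and on major arcs, with [e], [B], [h], [W] for the size of
    [eta], [b], [H] and the Fejer mass. In units of [W * U ^+ 3 / h] the Fejer shift costs [54 * 64]
    and the four other terms cost 1 each. *)
Lemma kernel_error_le (beta K e h B U L W q : R) :
  0 <= e -> 64 <= h -> 1 <= B -> 0 <= U -> 0 <= L -> 0 <= W -> 0 <= q ->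
  `|beta| <= K -> K <= h -> q <= h ^+ 7 ->
  h * U <= B -> B <= 2 * h * U -> B <= 32 * L -> 16 * L <= B -> L ^+ 4 <= 2 * W ->
  h ^+ 10 <= B -> e * B ^+ 3 * h ^+ 10 <= 1 ->
  U ^+ 3 * (8 * (e * (4 * K * B ^+ 3)) * W + 6 * U * (9 * L ^+ 3) + 16 * (e * (`|beta| * B ^+ 2)) * L * W)
    + W * (U * (4 * q * U + 8 * U ^+ 2 * e * (4 * q * K * B ^+ 3)))
  <= 60 * 64 / h * (W * U ^+ 3).
Proof.
move=> e0 h64 B1 U0 L0 W0 q0 betaK Kh qh hUB BhU BL LB L4 hB eB.
have b0 := normr_ge0 beta; have K0 : 0 <= K by lra.
have hpos : 0 < h by lra.
have hn n : 0 <= h ^+ n by rewrite exprn_ge0 // ltW.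
have B0 : 0 <= B by lra.
have eB0 : 0 <= e * B ^+ 3 by rewrite mulr_ge0 // exprn_ge0.
have eBh (x : R) : x <= h ^+ 9 -> e * B ^+ 3 * x <= h^-1.
  move=> xh; rewrite -[h^-1]mul1r ler_pdivlMr //; apply: le_trans eB.
  have -> : e * B ^+ 3 * x * h = e * B ^+ 3 * (h * x) by ring.
  by rewrite ler_wpM2l // exprS ler_wpM2l // ltW.
have h19 : h ^+ 2 <= h ^+ 8 by rewrite ler_eXn2l //; lra.
have h29 : 64 * h ^+ 8 <= h ^+ 9 by rewrite [leRHS]exprS ler_wpM2r.
have h1 : h <= h ^+ 2 by rewrite expr2; nra.
have h8 : 0 <= h ^+ 8 by [].
have t1 : 8 * (e * (4 * K * B ^+ 3)) <= h^-1.
  have -> : 8 * (e * (4 * K * B ^+ 3)) = e * B ^+ 3 * (32 * K) by ring.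
  by apply: eBh; lra.
have t3 : 16 * (e * (`|beta| * B ^+ 2)) * L <= h^-1.
  apply: le_trans (_ : _ <= e * B ^+ 3 * K) _; last by apply: eBh; lra.
  have -> : 16 * (e * (`|beta| * B ^+ 2)) * L = e * B ^+ 2 * (`|beta| * (16 * L)) by ring.
  have -> : e * B ^+ 3 * K = e * B ^+ 2 * (K * B) by ring.
  rewrite ler_wpM2l ?mulr_ge0 ?sqr_ge0 //; apply: ler_pM => //.
  by rewrite mulr_ge0.
have qK : q * K <= h ^+ 7 * h by apply: ler_pM.
have t5 : 8 * e * (4 * q * K * B ^+ 3) <= h^-1.
  have -> : 8 * e * (4 * q * K * B ^+ 3) = e * B ^+ 3 * (32 * (q * K)) by ring.
  apply: eBh; have : h ^+ 7 * h = h ^+ 8 by rewrite -exprSr.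
  by move=> e8; rewrite e8 in qK; lra.
have t4 : 4 * q <= U / h.
  rewrite ler_pdivlMr //.
  have : 8 * h ^+ 9 <= 2 * h * U.
    by apply: le_trans BhU; apply: le_trans hB; rewrite [leRHS]exprS ler_wpM2r //; lra.
  have -> : 8 * h ^+ 9 = 2 * h * (4 * h ^+ 7 * h) by ring.
  rewrite ler_pM2l; last by rewrite mulr_gt0.
  by apply: le_trans; rewrite ler_wpM2r ?(ltW hpos) // ler_wpM2l.
have t2 : 6 * U * (9 * L ^+ 3) <= 54 * 64 / h * W.
  have -> : 6 * U * (9 * L ^+ 3) = 54 * (U * L ^+ 3) by ring.
  have -> : 54 * 64 / h * W = 54 * (32 * (2 * W) / h) by field; rewrite gt_eqF.
  rewrite ler_wpM2l // ler_pdivlMr //.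
  have -> : U * L ^+ 3 * h = (h * U) * L ^+ 3 by ring.
  apply: le_trans (_ : _ <= 32 * L * L ^+ 3) _.
    by rewrite ler_wpM2r ?exprn_ge0 //; lra.
  by rewrite -mulrA -exprS ler_wpM2l.
have U3 : 0 <= U ^+ 3 by rewrite exprn_ge0.
have U2 : 0 <= U ^+ 2 by rewrite exprn_ge0.
have s1 : U ^+ 3 * (8 * (e * (4 * K * B ^+ 3)) * W + 6 * U * (9 * L ^+ 3) +
    16 * (e * (`|beta| * B ^+ 2)) * L * W) <= U ^+ 3 * (h^-1 * W + 54 * 64 / h * W + h^-1 * W).
  by rewrite ler_wpM2l // !lerD // ler_wpM2r.
have s2 : W * (U * (4 * q * U + 8 * U ^+ 2 * e * (4 * q * K * B ^+ 3)))
   <= W * (U * (U / h * U + U ^+ 2 * h^-1)).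
  rewrite !ler_wpM2l // lerD ?ler_wpM2r //.
  have -> : 8 * U ^+ 2 * e * (4 * q * K * B ^+ 3) = U ^+ 2 * (8 * e * (4 * q * K * B ^+ 3)) by ring.
  by rewrite ler_wpM2l.
apply: le_trans (lerD s1 s2) _.
have -> : U ^+ 3 * (h^-1 * W + 54 * 64 / h * W + h^-1 * W) + W * (U * (U / h * U + U ^+ 2 * h^-1))
   = (54 * 64 + 4) / h * (W * U ^+ 3) by ring.
rewrite ler_wpM2r ?mulr_ge0 // ler_wpM2r ?invr_ge0 ?(ltW hpos) //.
by rewrite -!natrM -natrD ler_nat.
Qed.

(** Either the kernel is at least [- 1 / H] times its mass, or the minor arc lemma and
    [near_multiple] put [theta] within [H ^ 16 / b ^ 4] of some [s / q] with [q <= H ^ 7], and the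
    major arc bound applies. *)
Lemma kernel_ge (beta c : R) (k H b : nat) (m a p n0 y0 : int) :
  (forall x q : int, q != 0 -> c <= `|q%:~R * beta ^+ 2 - x%:~R| * `|q%:~R| ^+ k) ->
  adapted_basis beta b m a p n0 y0 ->
  (4096 <= H)%N -> `|beta| + 2 <= H%:R -> 2 <= `|beta| * H%:R -> 1 <= c * H%:R ->
  H%:R ^+ (26 + 34 * k) <= b%:R :> R ->
  forall theta : R,
  - (60 * 64 / H%:R * (fejer_mass (b %/ 16) * (b %/ H)%:R ^+ 3))
    <= kernel b m a p n0 y0 (b %/ 16) (b %/ H) theta.
Proof.
move=> dioph basis H4096 betaH Hbeta cH bH theta.
have lin (x y z t : R) : z <= t + y -> 2 * x <= z -> y <= x -> x <= t by lra.
have minor (HU : (272 * H ^ 4 <= b %/ H)%N) := fun hlt =>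
  @kernel_minor_arc R theta b (b %/ 16) (b %/ H) H m a p n0 y0 H4096 HU hlt.
have H64 : (64 < H)%N by apply: leq_trans H4096.
clear H4096.
have H0 : (0 < H)%N by apply: leq_trans H64.
have h64 : 64 <= H%:R :> R by rewrite ler_nat ltnW.
set L := (b %/ 16)%N; set U := (b %/ H)%N; set h : R := H%:R in h64 betaH Hbeta cH bH *.
set B : R := b%:R in bH *.
have h0 : 0 < h by lra.
have h1 : 1 <= h by lra.
have hle i j : (i <= j)%N -> h ^+ i <= h ^+ j by move=> ij; rewrite ler_weXn2l.
have hn0 n : 0 <= h ^+ n by rewrite exprn_ge0 // ltW.
have hn1 n : 1 <= h ^+ n by rewrite exprn_ege1.
have hB n : (n <= 26)%N -> h ^+ n <= B.
  by move=> n26; apply: le_trans bH; apply: hle; apply: leq_trans n26 (leq_addr _ _).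
have B1 : 1 <= B by apply: le_trans (hB 0%N _).
have B0 : 0 < B by lra.
have BB : B <= B ^+ 2 by rewrite expr2 ler_peMl // ltW.
have Hb n : (n <= 26)%N -> (H ^ n <= b)%N by move=> /hB; rewrite /B /h -natrX ler_nat.
have U1 : (0 < U)%N.
  by rewrite /U divn_gt0 //; have := Hb 1%N isT; rewrite expn1.
have hUB : h * U%:R <= B by rewrite /h /B -natrM ler_nat mulnC leq_divM.
have BhU : B <= 2 * h * U%:R.
  apply: le_trans (_ : _ <= (U.+1 * H)%:R) _; first by rewrite ler_nat ltnW // ltn_ceil.
  have U2 : U.+1%:R <= 2 * U%:R :> R by rewrite -natrM ler_nat mul2n -addnn -addn1 leq_add2l.
  have -> : 2 * h * U%:R = 2 * U%:R * h by ring.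
  by rewrite natrM ler_wpM2r // ltW.
have b64 : (64 <= b)%N by apply: leq_trans (Hb 1%N isT); rewrite expn1; apply: ltnW.
have BL : B <= 32 * L%:R by rewrite /B -natrM ler_nat /L; move: b64; clear; lia.
have LB : 16 * L%:R <= B by rewrite /B -natrM ler_nat /L; clear; lia.
set W := fejer_mass L.
have W0 : 0 <= W := fejer_mass_ge0 _.
have [ge|lt_kernel] := leP (W * (U%:R * (U%:R * - (U%:R / h)))) (kernel b m a p n0 y0 L U theta).
  apply: le_trans ge.
  have -> : W * (U%:R * (U%:R * - (U%:R / h))) = - (1 / h * (W * U%:R ^+ 3)) by ring.
  rewrite lerN2 ler_wpM2r ?mulr_ge0 ?exprn_ge0 // ler_wpM2r ?invr_ge0 ?(ltW h0) //.
  by rewrite -natrM ler1n.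
have HU : (272 * H ^ 4 <= U)%N.
  rewrite -(ler_nat R) natrM natrX -/h -(ler_pM2l (_ : 0 < 2 * h)) ?mulr_gt0 //.
  apply: le_trans BhU; apply: le_trans (hB 7%N isT).
  have -> : h ^+ 7 = h * h * h ^+ 5 by ring.
  have -> : 2 * h * (272 * h ^+ 4) = (16 * 34) * h ^+ 5 by ring.
  by rewrite ler_wpM2r // ler_pM // (le_trans _ h64) // ler_nat.
have [q [w1 [w2 [w3 [/andP[q0 qH] hw1 hw2 hw3]]]]] := minor HU lt_kernel.
rewrite -/h in hw1 hw2 hw3.
(* [U >= B / (2 h)] turns [h ^ 12 / U ^ 2] into at most [4 h ^ 14 / B ^ 2]. *)
pose E := h ^+ 15 / B ^+ 2.
have toE (x : R) : `|x| * U%:R ^+ 2 <= h ^+ 12 -> `|x| <= E.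
  move=> hx; rewrite ler_pdivlMr ?exprn_gt0 //.
  apply: le_trans (_ : _ <= `|x| * (2 * h * U%:R) ^+ 2) _.
    by rewrite ler_wpM2l // lerXn2r // nnegrE ?mulr_ge0 ?(ltW B0) ?(ltW h0).
  have -> : `|x| * (2 * h * U%:R) ^+ 2 = 4 * h ^+ 2 * (`|x| * U%:R ^+ 2) by ring.
  have -> : h ^+ 15 = h * h ^+ 2 * h ^+ 12 by ring.
  apply: ler_pM => //; rewrite ?mulr_ge0 //.
  by rewrite ler_wpM2r // (le_trans _ h64) // ler_nat.
have approx := basis_approx basis; have approx_p := basis_approx_p basis.
have K_ge : `|beta| + 2 <= `|beta| + 2 by [].
have aK := basis_a_le basis K_ge; have pK := basis_p_le basis K_ge.
have /andP[m0 mb] := basis_m basis.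
have mb' : `|m%:~R| <= B by rewrite ger0_norm ?ler0z // /B -[b%:R]/(b%:Z%:~R) ler_int.
have bb' : `|b%:R| <= B by rewrite ger0_norm.
have ah : `|a%:~R| <= h * B by apply: le_trans aK _; rewrite ler_wpM2r // ltW.
have ph : `|p%:~R| <= h * B by apply: le_trans pK _; rewrite ler_wpM2r // ltW.
pose V := 2 * h * B ^+ 2.
have prodV (x y : R) : `|x| <= B -> `|y| <= h * B -> `|x * y| <= h * B ^+ 2.
  move=> hx hy; rewrite normrM; have -> : h * B ^+ 2 = B * (h * B) by ring.
  exact: ler_pM.
have hBB : 0 <= h * B ^+ 2 by rewrite mulr_ge0 ?sqr_ge0 // ltW.
have hBV : h * B ^+ 2 <= V by rewrite /V -mulrA ler_peMl // ler1n.
have V1 : `|(m * p)%:~R| <= V by rewrite intrM; apply: le_trans (prodV _ _ mb' ph) hBV.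
have V3 : `|(b%:Z * a)%:~R| <= V by rewrite intrM; apply: le_trans (prodV _ _ bb' ah) hBV.
have V2 : `|(m * a + b%:Z * p)%:~R| <= V.
  rewrite intrD !intrM; apply: le_trans (ler_normD _ _) _.
  apply: le_trans (lerD (prodV _ _ mb' ah) (prodV _ _ bb' ph)) _.
  by rewrite /V -mulrA mulr_natl mulr2n.
(* The powers of [B] cancel: the size of the integral relation depends on [h] only, so a large
   enough power of [h] below [b] makes it trivial. *)
have TE : 2 * E * V = 4 * h ^+ 16 by rewrite /E /V; field; rewrite gt_eqF.
have b0 := b_gt0 basis.
have T16 : 16 * (2 * E * V) < h ^+ 17.
  rewrite TE [h ^+ 17]exprS mulrA -natrM ltr_pM2r ?exprn_gt0 //.
  by rewrite /h ltr_nat.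
have beta2 : 4 <= beta ^+ 2 * h ^+ 2.
  rewrite -exprMn -real_normK ?num_real // normrM (ger0_norm (ltW h0)).
  have bh0 : 0 <= `|beta| * h by rewrite mulr_ge0 // ltW.
  have -> : 4 = 2 ^+ 2 :> R by ring.
  by apply: lerXn2r; rewrite ?nnegrE.
have [||||||||||||s hs] := @near_multiple R beta c (q%:R * theta) E V k m a b%:Z p w1 w2 w3 dioph
   (basis_det basis).
- by [].
- exact: approx_p.
- by apply: le_trans approx _; rewrite ler1n.
- exact: V1.
- exact: V2.
- exact: V3.
- exact: toE.
- exact: toE.
- exact: toE.
- by apply: lt_le_trans T16 _; apply: le_trans BB; apply: hB.
- rewrite -(ltr_pM2r (_ : 0 < h ^+ 2)) ?exprn_gt0 //.
  apply: le_lt_trans (_ : h ^+ 19 < _); last first.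
    apply: le_lt_trans (hB 19%N isT) _; rewrite mulrAC; apply: le_lt_trans BB _.
    by rewrite -[ltLHS]mul1r ltr_pM2r ?exprn_gt0 // (lt_le_trans _ beta2) // ltr1n.
  by rewrite -[h ^+ 19]/(h ^+ (17 + 2)) exprD ler_wpM2r // ltW.
(* [16 * T] is below [h ^ 17], the [k]-th power is at most [h ^ (33 k)] and [1 / c] is at most [h];
   the total exponent [18 + 33 k] fits in [26 + 34 k]. *)
- rewrite -(ltr_pM2r h0).
  apply: lt_le_trans (_ : h ^+ 17 * h ^+ (33 * k) * h <= _).
    rewrite ltr_pM2r // exprM.
    have le2 : (2 * (2 * E * V) ^+ 2) ^+ k <= (h ^+ 33) ^+ k.
      rewrite TE; have -> : 2 * (4 * h ^+ 16) ^+ 2 = 32 * h ^+ 32 by ring.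
      apply: lerXn2r; rewrite ?nnegrE ?mulr_ge0 //.
      by rewrite [leRHS]exprS ler_wpM2r // (le_trans _ h64) // ler_nat.
    apply: le_lt_trans (_ : _ <= 16 * (2 * E * V) * (h ^+ 33) ^+ k) _.
      by rewrite ler_wpM2l // TE !mulr_ge0.
    by rewrite ltr_pM2r // exprn_gt0 // exprn_gt0.
  apply: le_trans (_ : _ <= B) _.
    by rewrite -exprD -exprSr; apply: le_trans bH; apply: hle; clear; lia.
  apply: le_trans BB _; rewrite mulrAC -[leLHS]mul1r ler_wpM2r ?sqr_ge0 //.
rewrite intrM normrM -[(Posz b)%:~R]/(b%:R : R) (ger0_norm (ltW B0)) in hs.
(* [beta] is at least [2 / h] in size, so [a] is at least [B / h], and the bound on [theta] gains a
   second factor [B] from [b a]. *)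
have aB : B <= h * `|a%:~R|.
  have : `|a%:~R - beta * B| <= 1.
    by apply: le_trans approx; rewrite ler_peMr.
  have : `|beta * B| <= `|a%:~R| + `|a%:~R - beta * B|.
    by rewrite -[X in `|X| <= _](subKr (a%:~R)); apply: ler_normB.
  rewrite normrM (ger0_norm (ltW B0)) => le1 le2.
  have : `|beta| * B <= `|a%:~R| + 1 by apply: le_trans le1 _; rewrite lerD2l.
  rewrite -(ler_pM2l h0) mulrDr mulr1 => le3.
  have le4 : 2 * B <= h * (`|beta| * B).
    by rewrite mulrCA mulrA ler_wpM2r // ltW.
  by apply: lin le3 le4 (hB 1%N isT).
pose eta := theta - s%:~R / q%:R.
have q0R : (0 : R) < q%:R by rewrite ltr0n.
have etaE : s%:~R / q%:R + eta = theta by rewrite /eta addrC subrK.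
have eta_le : `|eta| * B ^+ 4 <= h ^+ 16.
  have : `|eta| <= `|q%:R * theta - s%:~R|.
    have -> : q%:R * theta - s%:~R = q%:R * eta by rewrite /eta; field; rewrite gt_eqF.
    by rewrite normrM ger0_norm // ler_peMl // ler1n.
  move=> /(@ler_wpM2r R (B ^+ 4)) => /(_ (exprn_ge0 _ (ltW B0))) /le_trans; apply.
  rewrite /E ler_pdivlMr ?exprn_gt0 // in hs.
  have -> : h ^+ 16 = h * h ^+ 15 by rewrite exprS.
  apply: le_trans (ler_wpM2l (ltW h0) hs).
  set d := `|_ - _|.
  have -> : h * (d * (B * `|a%:~R|) * B ^+ 2) = d * B ^+ 3 * (h * `|a%:~R|) by ring.
  have -> : d * B ^+ 4 = d * B ^+ 3 * B by ring.
  by rewrite ler_wpM2l //; apply: mulr_ge0; [exact: normr_ge0 | apply: exprn_ge0; exact: ltW].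
(* Here [26 = 16 + 10] is used: [h ^ 16] from the bound on [eta] and the [h ^ 10] required by
   [kernel_error_le]. *)
have eta_le' : `|eta| * B ^+ 3 * h ^+ 10 <= 1.
  rewrite -(ler_pM2r B0) mul1r; apply: le_trans (hB 26%N isT).
  have -> : `|eta| * B ^+ 3 * h ^+ 10 * B = `|eta| * B ^+ 4 * h ^+ 10 by ring.
  by rewrite -[h ^+ 26]/(h ^+ (16 + 10)) exprD ler_wpM2r.
have qh : q%:R <= h ^+ 7 by rewrite /h -natrX ler_nat.
have LUb : (2 + L + 4 * U + 2 * q <= b)%N.
  rewrite -(ler_nat R) -/B.
  have -> : (2 + L + 4 * U + 2 * q)%:R = 2 + L%:R + 4 * U%:R + 2 * q%:R :> R by ring.
  have Uh : 64 * U%:R <= B by apply: le_trans hUB; rewrite ler_wpM2r.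
  have h7B : 64 * h ^+ 7 <= B.
    by apply: le_trans (hB 8%N isT); rewrite [leRHS]exprS ler_wpM2r.
  have B64 : 64 <= B by rewrite ler_nat.
  move: Uh LB B64 (le_trans (ler_wpM2l (ler0n R 64) qh) h7B); clear; lra.
have near0 := @kernel_near0_ge R beta b m a p n0 y0 basis (`|beta| + 2) K_ge L U eta U1.
have {}near0 := near0 (leq_trans (leq_addr _ _) LUb).
have major := @kernel_major_arc_ge R beta b m a p n0 y0 basis (`|beta| + 2) K_ge L U q s eta _ q0 LUb _ near0.
rewrite etaE in major; apply: le_trans (major _); last first.
  have K0 : 0 <= `|beta| + 2 by rewrite addr_ge0.
  by rewrite !(mulr_ge0, addr_ge0, exprn_ge0) // ?(ltW B0) // W0.
rewrite lerN2 -/B -/W natrM.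
have -> : `|eta * (beta * B ^+ 2)| = `|eta| * (`|beta| * B ^+ 2).
  by rewrite normrM [ `|beta * _|]normrM [ `|B ^+ 2|]ger0_norm // sqr_ge0.
apply: kernel_error_le => //; rewrite ?lerDl //.
- exact: fejer_mass_ge.
- exact: hB.
Qed.

End KernelBound.

(** * Difference sets *)

Section DifferenceSets.
Context {R : realType}.

Lemma sum_ecos_mod (P : nat) (d : int) : (0 < P)%N -> `|d| < P%:Z ->
  \sum_(r < P) ecos (r%:R / P%:R * d%:~R : R) = if d == 0 then P%:R else 0.
Proof.
move=> P0 dP; case: eqP => [->|/eqP d0].
  under eq_bigr do rewrite mulr0 ecos0.
  by rewrite sumr_const card_ord.
rewrite -[RHS](@sum_ecos_root R d P P0).
  by apply: eq_bigr => r _; congr ecos; ring.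
apply/negP => /dvdzP[z dE]; rewrite dE normrM in dP d0 *.
have z0 : z != 0 by apply: contraNneq d0 => ->; rewrite mul0r.
have : (1 : int) <= `|z| by rewrite -gtz0_ge1 normr_gt0.
by move: dP; rewrite (ger0_norm (_ : 0 <= P%:Z)) //; nia.
Qed.

(* Weighting [|sum_(a in s) e(r a / P)|^2] by a cosine polynomial that is almost
   nonnegative, with frequencies avoiding [s - s], compares the term [r = 0] with
   the diagonal. *)
Lemma difference_free_size (N : nat) (s : seq int) (I : finType) (w : I -> R)
    (D : I -> int) (eps : R) :
  (0 < N)%N -> uniq s -> (forall a, a \in s -> 1 <= a <= N%:Z) ->
  (forall i a a', a \in s -> a' \in s -> a - a' != D i) ->
  (forall i, `|D i| <= N%:Z) -> 0 < \sum_i w i -> 0 <= eps ->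
  (forall theta : R, - (eps * \sum_i w i) <= \sum_i w i * ecos (theta * (D i)%:~R)) ->
  (size s)%:R <= 2 * N%:R * eps.
Proof.
move=> N0 us sN sD DN; set M := \sum_i w i => M0 eps0 kernel_ge.
(* Modulo [2 * N] no wrap-around occurs: [D i] plus or minus a difference of elements is less than
   [P] in absolute value. *)
pose P := (2 * N)%N; have P0 : (0 < P)%N by rewrite muln_gt0.
pose S (r : nat) : R := \sum_(a <- s) \sum_(a' <- s) ecos (r%:R / P%:R * (a - a')%:~R).
have S_ge0 r : 0 <= S r.
  have -> : S r = (\sum_(a <- s) ecos (r%:R / P%:R * a%:~R)) ^+ 2
                + (\sum_(a <- s) esin (r%:R / P%:R * a%:~R)) ^+ 2.
    rewrite !expr2 !big_distrlr /= -big_split; apply: eq_bigr => a _ /=.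
    by rewrite -big_split; apply: eq_bigr => a' _; rewrite intrB mulrBr ecosB.
  by rewrite addr_ge0 ?sqr_ge0.
pose T (r : nat) : R := \sum_i w i * ecos (r%:R / P%:R * (D i)%:~R).
have diff_lt a a' : a \in s -> a' \in s -> `|a - a'| < N%:Z.
  by move=> /sN /andP[? ?] /sN /andP[? ?]; lia.
have sumS : \sum_(r < P) S r = P%:R * (size s)%:R.
  rewrite /S exchange_big /= mulr_natr.
  have -> : P%:R *+ size s = \sum_(a <- s) P%:R :> R.
    by rewrite big_const_seq count_predT iter_addr_0.
  apply: eq_big_seq => a aS; rewrite exchange_big /= (bigD1_seq a) //=.
  rewrite sum_ecos_mod // ?subrr ?normr0 // eqxx big1_seq ?addr0 // => a' /andP[a'a a'S].
  have aP : `|a - a'| < P%:Z by have := diff_lt _ _ aS a'S; rewrite /P; lia.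
  by rewrite sum_ecos_mod // subr_eq0 eq_sym (negbTE a'a).
have sumTS : \sum_(r < P) T r * S r = 0.
  have -> : \sum_(r < P) T r * S r = \sum_i \sum_(a <- s) \sum_(a' <- s) w i *
     \sum_(r < P) ecos (r%:R / P%:R * (D i)%:~R) * ecos (r%:R / P%:R * (a - a')%:~R).
    under eq_bigr do rewrite /T mulr_suml.
    rewrite exchange_big /=; apply: eq_bigr => i _.
    under eq_bigr do rewrite /S mulr_sumr.
    rewrite exchange_big /=; apply: eq_bigr => a _.
    under eq_bigr do rewrite mulr_sumr.
    rewrite exchange_big /=; apply: eq_bigr => a' _.
    by rewrite mulr_sumr; apply: eq_bigr => r _; rewrite mulrA.
  apply: big1 => i _; apply: big1_seq => a /andP[_ aS]; apply: big1_seq => a' /andP[_ a'S].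
  apply/eqP; rewrite mulf_eq0; apply/orP; right; apply/eqP.
  (* The product of cosines has the frequencies [D i + (a - a')] and [D i - (a - a')], nonzero by
     the hypothesis on the pairs [(a', a)] and [(a, a')]. *)
  have prod (x y : R) : ecos x * ecos y = (ecos (x + y) + ecos (x - y)) / 2.
    by rewrite ecosD ecosB; field.
  have vanish (d : int) : d != 0 -> `|d| < P%:Z ->
      \sum_(r < P) ecos (r%:R / P%:R * d%:~R : R) = 0.
    by move=> d0 dP; rewrite sum_ecos_mod // (negbTE d0).
  under eq_bigr do rewrite prod -mulrDr -mulrBr -intrD -intrB.
  have aa' := diff_lt _ _ aS a'S; have Di := DN i.
  rewrite -mulr_suml big_split /= !vanish ?addr0 ?mul0r //; try by rewrite /P; lia.
    by have := sD i _ _ aS a'S; apply: contraNneq => /eqP; rewrite subr_eq0 eq_sym.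
  have := sD i _ _ a'S aS; apply: contraNneq => /eqP; rewrite addr_eq0 opprB => /eqP ->.
  by [].
have S0 : S 0%N = (size s)%:R ^+ 2.
  rewrite /S; under eq_bigr do under eq_bigr do rewrite mul0r mul0r ecos0.
  by rewrite !big_const_seq !count_predT !iter_addr_0 expr2 mulr_natr.
have T0 : T 0%N = M.
  by rewrite /T /M; apply: eq_bigr => i _; rewrite !mul0r ecos0 mulr1.
(* All terms [(eps * M + T r) * S r] are nonnegative, so their sum is at least the term [r = 0]. *)
have main : M * (size s)%:R ^+ 2 <= eps * M * (P%:R * (size s)%:R).
  have -> : eps * M * (P%:R * (size s)%:R) = \sum_(r < P) (eps * M + T r) * S r.
    under [RHS]eq_bigr do rewrite mulrDl.
    by rewrite big_split /= sumTS addr0 -mulr_sumr sumS.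
  rewrite (bigD1 (Ordinal P0)) //= S0 T0 -[leLHS]addr0; apply: lerD.
    by rewrite ler_wpM2r ?sqr_ge0 // lerDr mulr_ge0 // ltW.
  apply: sumr_ge0 => r _; apply: mulr_ge0 => //.
  by have := kernel_ge (r%:R / P%:R); rewrite -lerBlDl sub0r.
have [s0|s0] := posnP (size s).
  by rewrite s0 !mulr_ge0.
have s0R : (0 : R) < (size s)%:R by rewrite ltr0n.
have : M * (size s)%:R * (size s)%:R <= M * (size s)%:R * (2 * N%:R * eps).
  apply: le_trans (_ : _ <= eps * M * (P%:R * (size s)%:R)) _; first by rewrite -mulrA -expr2.
  by rewrite /P natrM le_eqVlt; apply/orP; left; apply/eqP; ring.
by rewrite ler_pM2l // mulr_gt0.
Qed.

End DifferenceSets.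

(** * Dirichlet approximation and construction of the adapted basis *)

Section AdaptedBasis.
Context {R : realType}.

(** Pigeonhole: the [Q + 1] fractional parts of [x * j] fall into [Q] cells of length [1 / Q]. *)
Lemma dirichlet_approx (x : R) (Q : nat) : (0 < Q)%N ->
  exists (a : int) (b : nat), [/\ (0 < b <= Q)%N & `|a%:~R - x * b%:R| * Q%:R <= 1].
Proof.
move=> Q0; have Q0R : (0 : R) < Q%:R by rewrite ltr0n.
pose fr (j : nat) : R := x * j%:R - (Num.floor (x * j%:R))%:~R.
have fr01 j : 0 <= fr j < 1.
  have /andP[h1 h2] := floor_itv (x * j%:R); rewrite intrD in h2.
  by rewrite /fr; apply/andP; split; lra.
have cell j : (Num.truncn (fr j * Q%:R) < Q)%N.
  have /andP[h1 h2] := fr01 j.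
  by rewrite truncn_lt_nat ?mulr_ge0 // gtr_pMl.
pose g (j : 'I_Q.+1) := Ordinal (cell j).
have ninj : ~~ injectiveb g.
  by apply/negP => /injectiveP /leq_card; rewrite !card_ord ltnn.
have [i [j [lt_ij gij]]] : exists i j : 'I_Q.+1, (i < j)%N /\ g i = g j.
  have /injectivePn[i [j ij gij]] := ninj.
  have [lt|lt|/val_inj eq] := ltngtP i j; [by exists i, j|by exists j, i|].
  by rewrite eq eqxx in ij.
exists (Num.floor (x * j%:R) - Num.floor (x * i%:R)), (j - i)%N.
split; first by have := ltn_ord j; lia.
rewrite natrB ?(ltnW lt_ij) // intrB.
have -> : (Num.floor (x * j%:R))%:~R - (Num.floor (x * i%:R))%:~R - x * (j%:R - i%:R)
   = fr i - fr j by rewrite /fr; ring.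
rewrite -{1}(gtr0_norm Q0R) -normrM mulrBl.
have tr (k : 'I_Q.+1) : (g k)%:R <= fr k * Q%:R < (g k)%:R + 1.
  have /andP[h1 h2] := fr01 k; rewrite /g /= truncn_le ?mulr_ge0 //= natr1; exact: truncnS_gt.
have := tr i; have := tr j; rewrite gij => /andP[? ?] /andP[? ?].
by rewrite ler_norml; apply/andP; split; lra.
Qed.

(** Dividing Dirichlet's approximation by its gcd makes [(b, a)] primitive without harming its
    quality; Bezout completes it to a basis, and reduction modulo [b] puts [m] in range. *)
Lemma exists_adapted_basis (beta : R) (Q : nat) : (0 < Q)%N ->
  exists (b : nat) (m a p n0 y0 : int), [/\ adapted_basis beta b m a p n0 y0,
    (b <= Q)%N & `|a%:~R - beta * b%:R| * Q%:R <= 1].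
Proof.
move=> Q0; have [a1 [b1 [/andP[b10 b1Q] ab1]]] := dirichlet_approx beta Q0.
have [u [v uv]] := Bezoutz a1 b1%:Z.
set g := gcdz a1 b1%:Z in uv.
have /dvdzP[a a1E] : (g %| a1)%Z by exact: dvdz_gcdl.
have /dvdzP[b' b1E] : (g %| b1%:Z)%Z by exact: dvdz_gcdr.
have g0 : 0 < g by rewrite /g lt_neqAle eq_sym gcdz_eq0 negb_and orbC -lt0n b10 /=.
have b'0 : 0 < b' by rewrite -(pmulr_lgt0 _ g0) -b1E.
pose b := absz b'; have bE : b%:Z = b' by rewrite /b gtz0_abs.
have b0 : (0 < b)%N by rewrite -ltz_nat bE.
have bb1 : (b <= b1)%N by rewrite -lez_nat bE b1E ler_peMr ?(ltW b'0) // -gtz0_ge1.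
have bez : u * a + v * b%:Z = 1.
  apply: (@mulIf _ g); first by rewrite gt_eqF.
  by rewrite mul1r mulrDl -!mulrA -a1E bE -b1E.
pose t := (u %/ b%:Z)%Z; pose m := (u %% b%:Z)%Z.
have uE : u = t * b%:Z + m by exact: divz_eq.
pose p := - v - t * a.
have det : m * a - b%:Z * p = 1 by rewrite -bez uE /p; ring.
have m0 : 0 <= m by rewrite modz_ge0 // gt_eqF // ltz_nat.
have mb : m < b%:Z by rewrite ltz_pmod.
pose c := (b %/ 2)%N.
(* [(m c, p c)] satisfies the equation for the origin; a multiple of [(b, a)] is added to bring its
   first coordinate into [[b, 2 b)]. *)
pose t' := ((m * c%:Z) %/ b%:Z)%Z; pose r := ((m * c%:Z) %% b%:Z)%Z.
have rE : m * c%:Z = t' * b%:Z + r by exact: divz_eq.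
have r0 : 0 <= r by rewrite modz_ge0 // gt_eqF // ltz_nat.
have rb : r < b%:Z by rewrite ltz_pmod.
have small (n : nat) : (0 < n <= Q)%N -> `|a1%:~R - beta * b1%:R| * Q%:R <= 1 ->
    `|a%:~R - beta * b%:R| * n%:R <= 1.
  move=> /andP[n0 nQ]; apply: le_trans.
  have -> : a1%:~R - beta * b1%:R = (a%:~R - beta * b%:R) * g%:~R :> R.
    rewrite a1E intrM -[b1%:R]/((Posz b1)%:~R : R) b1E -[b%:R]/((Posz b)%:~R : R) bE intrM; ring.
  rewrite normrM -mulrA ler_wpM2l //.
  apply: le_trans (_ : _ <= Q%:R) _; first by rewrite ler_nat.
  by rewrite ler_peMl // ger0_norm ?ler0z ?ler1z ?(ltW g0) // -gtz0_ge1.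
exists b, m, a, p, (r + b%:Z), (p * c%:Z - t' * a + a); split; last 2 first.
- exact: leq_trans b1Q.
- by apply: small => //; rewrite Q0 /=.
split => //.
- by rewrite m0 ltW.
- by apply: small => //; rewrite b0 (leq_trans bb1).
- have -> : r = m * c%:Z - t' * b%:Z by rewrite rE; ring.
  have -> : (m * c%:Z - t' * b%:Z + b%:Z) * a - b%:Z * (p * c%:Z - t' * a + a)
     = (m * a - b%:Z * p) * c%:Z by ring.
  by rewrite det mul1r.
- apply/andP; split; first by rewrite lerDr.
  by move: rb; clear; lia.
Qed.

End AdaptedBasis.

(** * Choice of parameters and the power saving *)

Section Final.
Context {R : realType}.

Lemma kernel_pairs (b : nat) (m a p n0 y0 : int) (L U : nat) (theta : R) :
  kernel b m a p n0 y0 L U theta =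
  \sum_(i : 'I_L * ('I_U * ('I_U * 'I_U))) fejer_weight L i.1 *
    ecos (theta * (xpt b m n0 (i.2.2.1 + i.2.1) (i.1 + i.2.1 + i.2.2.2) *
                   ypt a p y0 (i.2.2.1 + i.2.1) (i.1 + i.2.1 + i.2.2.2))%:~R).
Proof.
rewrite /kernel; under eq_bigr do under eq_bigr do rewrite pair_big /=.
under eq_bigr do rewrite pair_big /= mulr_sumr.
by rewrite pair_big.
Qed.

(** The kernel has frequencies [n floor (beta n)] of size at most [H * b ^ 4 <= N], so
    [difference_free_size] applies with [eps = 60 * 64 / H]. *)
Lemma bracket_difference_bound (beta c : R) (k H b N : nat) (m a p n0 y0 : int) (A : {fset int}) :
  (forall x q : int, q != 0 -> c <= `|q%:~R * beta ^+ 2 - x%:~R| * `|q%:~R| ^+ k) ->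
  adapted_basis beta b m a p n0 y0 ->
  (4096 <= H)%N -> `|beta| + 2 <= H%:R -> 2 <= `|beta| * H%:R -> 1 <= c * H%:R ->
  H%:R ^+ (26 + 34 * k) <= b%:R :> R -> (H * b ^ 4 <= N)%N ->
  (forall a : int, a \in A -> 1 <= a <= N%:Z) -> no_bracket_difference beta A ->
  (#|` A|)%:R <= 120 * 64 * (N%:R / H%:R) :> R.
Proof.
move=> dioph basis H4096 betaH Hbeta cH bH bN AN nodiff.
have kge := kernel_ge dioph basis H4096 betaH Hbeta cH bH.
have H64 : (64 <= H)%N by apply: leq_trans H4096.
clear H4096 dioph.
have H0 : (0 < H)%N by apply: leq_trans H64.
have H0R : (0 : R) < H%:R by rewrite ltr0n.
have b0 := b_gt0 basis.
have Hb : (H <= b)%N.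
  rewrite -(ler_nat R); apply: le_trans bH; rewrite -{1}[H%:R]expr1.
  by rewrite ler_weXn2l ?ler1n.
set L := (b %/ 16)%N in kge; set U := (b %/ H)%N in kge.
have L1 : (0 < L)%N by rewrite divn_gt0 // (leq_trans _ Hb) // (leq_trans _ H64).
have U1 : (0 < U)%N by rewrite divn_gt0.
have L16 : (16 * L <= b)%N by rewrite mulnC leq_divM.
have U64 : (64 * U <= b)%N.
  by apply: leq_trans (leq_divM b H); rewrite mulnC leq_mul2l H64 orbT.
have b1 : (1 : R) <= b%:R by rewrite ler1n.
have N0 : (0 < N)%N by apply: leq_trans bN; rewrite muln_gt0 H0 expn_gt0 b0.
pose D (i : 'I_L * ('I_U * ('I_U * 'I_U))) : int :=
  xpt b m n0 (i.2.2.1 + i.2.1) (i.1 + i.2.1 + i.2.2.2) *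
  ypt a p y0 (i.2.2.1 + i.2.1) (i.1 + i.2.1 + i.2.2.2).
have range (i : 'I_L * ('I_U * ('I_U * 'I_U))) :
    (4 * (3 + (i.2.2.1 + i.2.1) + (i.1 + i.2.1 + i.2.2.2)) <= b)%N.
  case: i => [[j jL] [[s sU] [[u uU] [v vU]]]] /=.
  by move: L16 U64 L1 U1 jL sU uU vU; clear; lia.
have sumw : \sum_(i : 'I_L * ('I_U * ('I_U * 'I_U))) fejer_weight L i.1 = fejer_mass L * U%:R ^+ 3 :> R.
  rewrite /fejer_mass mulr_suml -(pair_bigA _ (fun (j : 'I_L) _ => fejer_weight L j)) /=.
  apply: eq_bigr => j _; rewrite sumr_const !card_prod card_ord -[LHS]mulr_natr !natrM.
  ring.
have massU : 0 < fejer_mass L * U%:R ^+ 3 :> R.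
  rewrite mulr_gt0 ?exprn_gt0 ?ltr0n //.
  have := @fejer_mass_ge R L; have : 0 < L%:R ^+ 4 :> R by rewrite exprn_gt0 ?ltr0n.
  lra.
have -> : 120 * 64 * (N%:R / H%:R) = 2 * N%:R * (60 * 64 / H%:R) :> R by field; rewrite gt_eqF.
have point (i : 'I_L * ('I_U * ('I_U * 'I_U))) : exists n : nat, [/\ (b <= n)%N,
    D i = n%:Z * Num.floor (beta * n%:R) & `|D i| <= (H * b ^ 4)%N%:Z].
  set x := xpt b m n0 (i.2.2.1 + i.2.1) (i.1 + i.2.1 + i.2.2.2).
  have rng := range i.
  have x0 : 0 <= x := xpt_ge0 basis _ _.
  have xE : x = (absz x)%:Z by rewrite gez0_abs.
  have bx : b%:Z <= x.
    have /andP[n1 n2] := basis_n0 basis; have /andP[m0 mb] := basis_m basis.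
    by rewrite /x /xpt -addrA; apply: le_trans n1 _; rewrite lerDl addr_ge0 // mulr_ge0.
  have rng2 : (2 + (i.2.2.1 + i.2.1) + (i.1 + i.2.1 + i.2.2.2) <= b)%N.
    by move: rng; clear; lia.
  have rng3 : (2 * (i.2.2.1 + i.2.1) <= b)%N by move: rng; clear; lia.
  have xb := xpt_le_sqr basis rng2; have K_ge : `|beta| + 2 <= `|beta| + 2 by [].
  have yb := ypt_le basis K_ge rng2 rng3.
  exists (absz x); split.
  - by rewrite -lez_nat -xE.
  - rewrite /D -/x -xE; congr (_ * _); rewrite -(ypt_floor basis rng) -/x.
    by congr Num.floor; congr (_ * _); rewrite [in LHS]xE.
  - rewrite -(ler_int R) intr_norm /D -/x intrM normrM -[(Posz _)%:~R]/(_%:R : R).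
    have -> : (H * b ^ 4)%:R = b%:R ^+ 2 * (H%:R * b%:R ^+ 2) :> R by ring.
    apply: ler_pM => //; first by rewrite ger0_norm // ler0z.
    by apply: le_trans yb _; rewrite ler_wpM2r ?sqr_ge0.
apply: (@difference_free_size R N (enum_fset A) _
  (fun i : 'I_L * ('I_U * ('I_U * 'I_U)) => fejer_weight L i.1) D (60 * 64 / H%:R)) => //.
- exact: fset_uniq.
- move=> i a1 a2 a1A a2A; apply/negP => /eqP aD.
  have [n [bn DE _]] := point i; rewrite DE in aD.
  (* For equal elements the frequency must be nonzero: [n >= b >= H] makes [beta n] at least 2 in
     size, so its floor is not 0. *)
  have [a12|a12] := eqVneq a1 a2; last by apply: (nodiff a1 a2 n) => //; apply: leq_trans bn.
  move: aD; rewrite a12 subrr => /esym/eqP; rewrite mulf_eq0 => /orP[/eqP[n0E]|/eqP fl0].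
    by rewrite n0E leqNgt b0 in bn.
  have := floor_itv (beta * n%:R); rewrite fl0 add0r => /andP[f0 f1].
  have : `|beta * n%:R| < 1 by rewrite ger0_norm.
  rewrite normrM (ger0_norm (ler0n _ n)) ltNge => /negP; apply.
  have : `|beta| * H%:R <= `|beta| * n%:R by rewrite ler_wpM2l // ler_nat (leq_trans Hb).
  lra.
- move=> i; have [n [_ _ Db]] := point i; apply: le_trans Db _; by rewrite lez_nat.
- by rewrite sumw.
- by rewrite !mulr_ge0 ?invr_ge0.
- by move=> theta; rewrite sumw -kernel_pairs; apply: kge.
Qed.

Lemma bracket_difference_power_saving (beta : R) :
  irrational beta -> irrational (beta ^+ 2) -> non_liouville beta -> non_liouville (beta ^+ 2) ->
  exists H0 E : nat, (0 < E)%N /\ forall (H N : nat) (A : {fset int}), (H0 <= H)%N -> (H ^ E <= N)%N ->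
    (forall a : int, a \in A -> 1 <= a <= N%:Z) -> no_bracket_difference beta A ->
    (#|` A|)%:R <= 120 * 64 * (N%:R / H%:R) :> R.
Proof.
move=> irr1 irr2 nl1 nl2.
have [c1 [k1 [c10 dioph1]]] := irrational_non_liouville irr1 nl1.
have [c [k [c0 dioph]]] := irrational_non_liouville irr2 nl2.
have beta0 : 0 < `|beta|.
  rewrite normr_gt0; apply: contra_notN irr1 => /eqP ->.
  by exists 0 => //; rewrite rmorph0.
pose e := (26 + 34 * k)%N.
pose H1 := (Num.truncn (Num.max (`|beta| + 2) (Num.max (2 / `|beta|) (Num.max c^-1 c1^-1)))).+1.
have H1P : Num.max (`|beta| + 2) (Num.max (2 / `|beta|) (Num.max c^-1 c1^-1)) <= H1%:R.
  by rewrite ltW // truncnS_gt.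
rewrite !ge_max in H1P; have /and4P[hb1 hb2 hc hc1] := H1P.
exists (maxn 4096 H1), (4 * (e * k1 + 2) + 1)%N; split; first by rewrite addn1.
move=> H N A; rewrite geq_max => /andP[H4096 HH1] HN AN nodiff.
have {}HH1 : H1%:R <= H%:R :> R by rewrite ler_nat.
have H0 : (0 < H)%N by apply: leq_trans H4096.
have H0R : (0 : R) < H%:R by rewrite ltr0n.
(* [Q] bounds [b] above, so [H * b ^ 4] is at most the chosen power of [H]; it is also large enough
   to force [b >= H ^ e]. *)
pose Q := (H ^ (e * k1 + 2))%N.
have Q0 : (0 < Q)%N by rewrite expn_gt0 H0.
have [b [m [a [p [n0 [y0 [basis bQ abQ]]]]]]] := exists_adapted_basis beta Q0.
have b0 := b_gt0 basis; have b1 : (1 : R) <= b%:R by rewrite ler1n.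
apply: (bracket_difference_bound dioph basis) => //.
- exact: le_trans hb1 HH1.
- by rewrite mulrC -ler_pdivrMr //; apply: le_trans hb2 HH1.
- by rewrite mulrC -ler_pdivrMr // mul1r; apply: le_trans hc HH1.
(* With [b < H ^ e] the error [1 / Q] would violate the Diophantine bound for [beta], since
   [b ^ k1 <= H ^ (e k1)] and [c1 * H >= 1]; the extra 2 in the exponent of [Q] makes this
   strict. *)
- rewrite leNgt; apply/negP => bH.
  have bz : b%:Z != 0 by rewrite -[0]/(Posz 0) eqz_nat -lt0n.
  have := dioph1 a b%:Z bz; rewrite -[b%:Z%:~R]/(b%:R : R) (ger0_norm (ler0n _ b)).
  rewrite leNgt => /negP; apply.
  have bk : b%:R ^+ k1 <= H%:R ^+ (e * k1) :> R.
    by rewrite exprM; apply: lerXn2r; rewrite ?nnegrE ?exprn_ge0 // ltW.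
  have Qr : Q%:R = H%:R ^+ (e * k1) * H%:R ^+ 2 :> R by rewrite /Q natrX exprD.
  have QR : (0 : R) < Q%:R by rewrite ltr0n.
  rewrite -(ltr_pM2r QR).
  apply: le_lt_trans (_ : H%:R ^+ (e * k1) < _).
    rewrite mulrAC -[leRHS]mul1r; apply: ler_pM => //.
    - by rewrite mulr_ge0.
    - exact: exprn_ge0.
    - by rewrite distrC [b%:R * _]mulrC.
  rewrite Qr mulrCA -[ltLHS]mulr1 ltr_pM2l ?exprn_gt0 //.
  have cH : 1 <= c1 * H%:R by rewrite mulrC -ler_pdivrMr // mul1r; apply: le_trans hc1 HH1.
  rewrite expr2 mulrA; apply: le_lt_trans cH _; rewrite ltr_pMr ?mulr_gt0 // ltr1n.
  by apply: leq_trans H4096.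
- apply: leq_trans HN; rewrite addn1 [leqRHS]expnS leq_mul2l; apply/orP; right.
  by rewrite mulnC expnM leq_exp2r.
Qed.

End Final.

Local Open Scope fset_scope.

Theorem theorem1p1 (R : realType) :
  exists C : R, 0 < C /\
    forall beta : R,
      irrational beta -> irrational (beta ^+ 2) ->
      non_liouville beta -> non_liouville (beta ^+ 2) ->
      exists c : R, 0 < c /\
        forall (N : nat) (A : {fset int}),
          (0 < N)%N ->
          (forall a : int, a \in A -> 1 <= a <= N%:Z) ->
          no_bracket_difference beta A ->
          (#|` A|)%:R <= C * (N%:R `^ (1 - c)).
Proof.
exists (120 * 64); split; first by rewrite mulr_gt0.
move=> beta irr1 irr2 nl1 nl2.
have [H0 [E [E0 saving]]] := bracket_difference_power_saving irr1 irr2 nl1 nl2.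
(* The saving will be used at [H ^ H0.+1], which exceeds [H0] once [H >= 2]. The threshold depending
   on [beta] thus enters only the exponent, and the constant stays absolute. *)
pose E' := (H0.+1 * E)%N.
have E'0 : (0 < E')%N by rewrite muln_gt0.
have E'R : (0 : R) < (2 * E')%:R by rewrite ltr0n muln_gt0.
exists ((2 * E')%:R^-1); split; first by rewrite invr_gt0.
move=> N A N0 AN nodiff.
set x : R := N%:R `^ (2 * E')%:R^-1.
have N1 : (1 : R) <= N%:R by rewrite ler1n.
have xE : x ^+ (2 * E') = N%:R.
  by rewrite -powR_mulrn ?powR_ge0 // -powRrM mulVf ?gt_eqF // powRr1.
have x0 : 0 < x by rewrite powR_gt0 // ltr0n.
have -> : N%:R `^ (1 - (2 * E')%:R^-1) = N%:R / x.
  by rewrite powRB ?powRr1 // pnatr_eq0 -lt0n N0 implybT.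
(* A saving factor [x] below 64 is absorbed by the constant, through the trivial bound by [N]. *)
have [x64|x64] := ltP x 64.
  have sizeN : (#|` A| <= N)%N.
    have sub : {subset A <= [seq i.+1%:Z | i <- iota 0 N]}.
      move=> a /AN /andP[a1 aN]; apply/mapP; exists (absz a).-1; first by rewrite mem_iota; lia.
      by lia.
    by have := uniq_leq_size (fset_uniq A) sub; rewrite size_map size_iota.
  apply: le_trans (_ : _ <= N%:R) _; first by rewrite ler_nat.
  rewrite mulrA ler_pdivlMr // mulrC ler_wpM2r //.
  by apply: le_trans (ltW x64) _; rewrite -natrM ler_nat.
(* [H] lies between [x] and [x ^+ 2]; the square accounts for the factor 2 in the exponent. *)
pose H := (Num.truncn x).+1.
have xH : x < H%:R by rewrite truncnS_gt.
have Hx : H%:R <= x ^+ 2.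
  have tx : (Num.truncn x)%:R <= x by rewrite truncn_le // ltW.
  rewrite /H -natr1; nra.
have H64 : (64 < H)%N by rewrite -(ltr_nat R); apply: le_lt_trans x64 xH.
have HN : ((H ^ H0.+1) ^ E <= N)%N.
  rewrite -expnM -(ler_nat R) natrX -xE [leRHS]exprM.
  by apply: lerXn2r; rewrite ?nnegrE ?sqr_ge0.
have H0H : (H0 <= H ^ H0.+1)%N.
  by apply: leq_trans (ltnW (ltn_expl H0 (_ : 1 < H)%N)) _; rewrite ?leq_exp2l //; apply: leq_trans H64.
apply: le_trans (saving _ _ _ H0H HN AN nodiff) _.
rewrite ler_wpM2l ?mulr_ge0 // ler_wpM2l // lef_pV2 ?posrE // ?ltr0n ?expn_gt0 //.
apply: le_trans (ltW xH) _; rewrite ler_nat -{1}[H]expn1 leq_exp2l //.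
by apply: leq_trans H64.
Qed.
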